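(* There exist a universal constant $\xi>0$ and a first-order sentence $\psi$ over the signature $\{E\}$ of graphs such that the class $\{G\mid G \text{ a finite simple undirected graph of maximum degree at most } 3,\ G\models\psi\}$ is infinite and consists of $\xi$-expanders.
   Context: For a finite simple undirected graph $G=(V,E)$ with $N$ vertices and $S\subseteq V$, let $\langle S,V\setminus S\rangle_G$ be the set of edges with one endpoint in $S$ and the other in $V\setminus S$, and $h(S):=|\langle S,V\setminus S\rangle_G|/|S|$. The expansion ratio is $h(G):=\min\{h(S)\mid S\subset V,\ 0<|S|\le N/2\}$. A graph $G$ is a $\xi$-expander if $h(G)\ge\xi$. Graphs are viewed as first-order structures with a symmetric irreflexive binary relation $E$. *)

(* Defs.v *)
From HB Require Import structures.
From mathcomp Require Import all_boot all_order all_algebra.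
From mathcomp Require Import reals constructive_ereal.

Set Implicit Arguments.
Unset Strict Implicit.
Unset Printing Implicit Defensive.

Import Order.TTheory GRing.Theory Num.Theory.

Local Open Scope ring_scope.

Record sgraph := SGraph {
  vertex :> finType;
  edge : rel vertex;
  edge_sym : symmetric edge;
  edge_irr : irreflexive edge
}.

Arguments edge {s}.

Definition isomorphic (G H : sgraph) : Prop :=
  exists f : G -> H, bijective f /\ {mono f : x y / edge x y >-> edge x y}.

Definition degree (G : sgraph) (x : G) : nat := #|[set y : G | edge x y]|.

Definition max_degree (G : sgraph) : nat := \max_(x : G) degree x.

(* Edges are unordered pairs, represented by two-element sets of vertices. *)
Definition edge_boundary (G : sgraph) (S : {set G}) : {set {set G}} :=
  [set [set x; y] | x in S, y in ~: S & edge x y].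

Definition cut_ratio (R : realType) (G : sgraph) (S : {set G}) : R :=
  #|edge_boundary S|%:R / #|S|%:R.

(* No set S qualifies when G has at most one vertex; the minimum over the
   empty family is then +oo. In all other cases the value is finite. *)
Definition expansion_ratio (R : realType) (G : sgraph) : \bar R :=
  \big[Order.min/+oo%E]_(S : {set G} | (0 < #|S|)%N && (2 * #|S| <= #|G|)%N)
    (cut_ratio R S)%:E.

Definition expander (R : realType) (xi : R) (G : sgraph) : Prop :=
  (xi%:E <= expansion_ratio R G)%E.

(* First-order logic with equality over the signature {E}. Variables are
   well-scoped de Bruijn indices: [formula n] has its free variables among
   0, ..., n-1, and a quantifier binds index 0. *)
Inductive formula : nat -> Type :=
  | FFalse n : formula n
  | FEq n of 'I_n & 'I_n : formula n
  | FEdge n of 'I_n & 'I_n : formula n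
  | FNot n of formula n : formula n
  | FAnd n of formula n & formula n : formula n
  | FOr n of formula n & formula n : formula n
  | FImp n of formula n & formula n : formula n
  | FAll n of formula n.+1 : formula n
  | FEx n of formula n.+1 : formula n.

Definition sentence := formula 0.

Definition env_cons (V : Type) (n : nat) (x : V) (v : 'I_n -> V)
    (i : 'I_n.+1) : V :=
  if unlift ord0 i is Some j then v j else x.

Fixpoint sat (G : sgraph) (n : nat) (phi : formula n) : ('I_n -> G) -> bool :=
  match phi in formula n return ('I_n -> G) -> bool with
  | FFalse _ => fun _ => false
  | FEq _ i j => fun v => v i == v j
  | FEdge _ i j => fun v => edge (v i) (v j)
  | FNot _ f => fun v => ~~ sat f v
  | FAnd _ f g => fun v => sat f v && sat g v
  | FOr _ f g => fun v => sat f v || sat g v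
  | FImp _ f g => fun v => sat f v ==> sat g v
  | FAll _ f => fun v => [forall x : G, sat f (env_cons x v)]
  | FEx _ f => fun v => [exists x : G, sat f (env_cons x v)]
  end.

Definition empty_env (V : Type) (i : 'I_0) : V :=
  match notF (ltn_ord i) with end.

Definition models (G : sgraph) (psi : sentence) : bool :=
  sat psi (@empty_env G).

(* Classes of graphs are counted up to isomorphism. *)
Definition finite_class (C : sgraph -> Prop) : Prop :=
  exists (k : nat) (F : 'I_k -> sgraph),
    forall G, C G -> exists i : 'I_k, isomorphic G (F i).

Definition infinite_class (C : sgraph -> Prop) : Prop := ~ finite_class C.

Definition bounded_degree_models (d : nat) (psi : sentence) (G : sgraph) :
    Prop :=
  (max_degree G <= d)%N /\ models G psi.

(* Main.v *)
Require Import Defs.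
From HB Require Import structures.
From mathcomp Require Import all_boot all_order all_algebra.
From mathcomp Require Import boolp reals constructive_ereal.
From mathcomp Require Import zify ring lra.

Import Order.TTheory GRing.Theory Num.Theory.

Set Implicit Arguments.
Unset Strict Implicit.
Unset Printing Implicit Defensive.

(** The models are towers of expanders. A vertex of a tower carries labelled
    permutations [pi i] and either no child or one child for every element of a
    fixed set [B]; there is a unique root. The permutations of a child are
    computed from those of its parent by a directed version of the zig-zag
    product of the squared graph with a fixed expander on [B], which is a
    local, hence first-order, condition. Starting from the one-point graph at
    the root, every level has spectral ratio at most [1/2].

    First-order logic cannot forbid rootless components directly, but the
    zig-zag product lifts connected sets to connected sets: a closed set
    avoiding the root is a union of full families of siblings, so it has at
    least four times as many elements as its set of parents, and descending
    must reach the root. Hence the leaves are exactly one level. The tree edges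
    and the expansion of the leaf level, which contains at least three quarters
    of the vertices, make the whole tower an expander.

    The fixed expander is the graph on [F^8], [F] a large finite field, joining
    [a] to [a + y (1, x, ..., x^7)]. The averages along the directions given by
    distinct [x] are commuting projections, eight of which kill all functions
    of mean zero, so the walk contracts the squared norm of such functions by
    [7 / #|F|].

    A tower is coded by a graph of maximum degree 3 by replacing each vertex
    with a rigid comb whose teeth are the ports of the coloured edges. *)

(** * First-order definable properties *)

(** Definability is stated semantically, so that the final sentence can be assembled by closure
    lemmas instead of being written out with de Bruijn indices. *)
Definition fo n (P : forall G : sgraph, ('I_n -> G) -> Prop) : Prop :=
  exists phi : formula n, forall G v, sat phi v <-> P G v.

Lemma fo_ext n (P Q : forall G : sgraph, ('I_n -> G) -> Prop) :
  (forall G v, P G v <-> Q G v) -> fo P -> fo Q.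
Proof. by move=> PQ [phi hphi]; exists phi => G v; rewrite hphi. Qed.

(** Excluded middle picks a true or a false formula. This covers the conditions on labels and cells,
    which do not depend on the graph. *)
Lemma fo_cst n (Q : Prop) : fo (fun G (_ : 'I_n -> G) => Q).
Proof.
have [q|nq] := pselect Q; last by exists (FFalse n) => G v; split.
by exists (FNot (FFalse n)) => G v; split.
Qed.

Lemma fo_eq n (i j : 'I_n) : fo (fun G v => v i = v j).
Proof. by exists (FEq i j) => G v /=; split=> /eqP. Qed.

Lemma fo_edge n (i j : 'I_n) : fo (fun G v => edge (v i) (v j)).
Proof. by exists (FEdge i j). Qed.

Lemma fo_not n (P : forall G : sgraph, ('I_n -> G) -> Prop) :
  fo P -> fo (fun G v => ~ P G v).
Proof.
move=> [phi hp]; exists (FNot phi) => G v /=; rewrite -hp.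
by split=> [/negP|/negP].
Qed.

Lemma fo_and n (P Q : forall G : sgraph, ('I_n -> G) -> Prop) :
  fo P -> fo Q -> fo (fun G v => P G v /\ Q G v).
Proof.
move=> [phi hp] [chi hq]; exists (FAnd phi chi) => G v /=.
by rewrite -hp -hq; split=> /andP.
Qed.

Lemma fo_or n (P Q : forall G : sgraph, ('I_n -> G) -> Prop) :
  fo P -> fo Q -> fo (fun G v => P G v \/ Q G v).
Proof.
move=> [phi hp] [chi hq]; exists (FOr phi chi) => G v /=.
by rewrite -hp -hq; split=> /orP.
Qed.

Lemma fo_imp n (P Q : forall G : sgraph, ('I_n -> G) -> Prop) :
  fo P -> fo Q -> fo (fun G v => P G v -> Q G v).
Proof.
move=> [phi hp] [chi hq]; exists (FImp phi chi) => G v /=.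
by rewrite -hp -hq; split=> /implyP.
Qed.

Definition env_tail (V : Type) n (w : 'I_n.+1 -> V) (i : 'I_n) : V :=
  w (lift ord0 i).

Lemma env_tail_cons (V : Type) n (x : V) (v : 'I_n -> V) :
  env_tail (env_cons x v) = v.
Proof. by apply: funext => i; rewrite /env_tail /env_cons liftK. Qed.

Lemma env_cons0 (V : Type) n (x : V) (v : 'I_n -> V) :
  env_cons x v ord0 = x.
Proof. by rewrite /env_cons unlift_none. Qed.

Lemma fo_all n (P : forall G : sgraph, ('I_n -> G) -> G -> Prop) :
  fo (fun G (w : 'I_n.+1 -> G) => P G (env_tail w) (w ord0)) ->
  fo (fun G v => forall x, P G v x).
Proof.
move=> [phi hp]; exists (FAll phi) => G v /=; split.
  by move=> /forallP h x; move: (h x); rewrite hp env_tail_cons env_cons0.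
by move=> h; apply/forallP => x; rewrite hp env_tail_cons env_cons0.
Qed.

Lemma fo_fin_all (I : finType) n (P : I -> forall G : sgraph, ('I_n -> G) -> Prop) :
  (forall i, fo (P i)) -> fo (fun G v => forall i, P i G v).
Proof.
move=> hP; suff: fo (fun G v => forall i, i \in enum I -> P i G v).
  apply: fo_ext => G v; split=> [h i|h i _]; last exact: h.
  by apply: h; rewrite mem_enum.
elim: (enum I) => [|a s ih].
  by apply: fo_ext (@fo_cst n True) => G v; split.
have := fo_and (hP a) ih; apply: fo_ext => G v; split=> [[ha hs] i|h].
  by rewrite in_cons => /orP[/eqP->//|hi]; exact: hs hi.
split; first by apply: h; rewrite mem_head.
by move=> i hi; apply: h; rewrite in_cons hi orbT.
Qed.

Lemma fo_fin_ex (I : finType) n (P : I -> forall G : sgraph, ('I_n -> G) -> Prop) :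
  (forall i, fo (P i)) -> fo (fun G v => exists i, P i G v).
Proof.
move=> hP; apply: fo_ext (fo_not (fo_fin_all (fun i => fo_not (hP i)))).
by move=> G v; split=> [/existsNP[i /contrapT]|[i h1 h2]]; [exists i|apply: h2 h1].
Qed.

Fixpoint rename n (phi : formula n) : forall m, ('I_n -> 'I_m) -> formula m :=
  match phi in formula n return forall m, ('I_n -> 'I_m) -> formula m with
  | FFalse _ => fun m _ => FFalse m
  | FEq _ i j => fun _ s => FEq (s i) (s j)
  | FEdge _ i j => fun _ s => FEdge (s i) (s j)
  | FNot _ f => fun _ s => FNot (rename f s)
  | FAnd _ f g => fun _ s => FAnd (rename f s) (rename g s)
  | FOr _ f g => fun _ s => FOr (rename f s) (rename g s)
  | FImp _ f g => fun _ s => FImp (rename f s) (rename g s)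
  | FAll _ f => fun _ s => FAll (rename f (env_cons ord0 (lift ord0 \o s)))
  | FEx _ f => fun _ s => FEx (rename f (env_cons ord0 (lift ord0 \o s)))
  end.

Lemma env_cons_rename (V : Type) n m (x : V) (v : 'I_m -> V) (s : 'I_n -> 'I_m) :
  env_cons x v \o env_cons ord0 (lift ord0 \o s) = env_cons x (v \o s).
Proof.
apply: funext => i; rewrite /env_cons /=; case: (unlift ord0 i) => [j|] /=.
  by rewrite liftK.
by rewrite unlift_none.
Qed.

Lemma sat_rename (G : sgraph) n (phi : formula n) :
  forall m (s : 'I_n -> 'I_m) (v : 'I_m -> G),
  sat (rename phi s) v = sat phi (v \o s).
Proof.
elim: phi => //= {}n => [f ih|f ihf g ihg|f ihf g ihg|f ihf g ihg|f ih|f ih] m s v;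
  rewrite ?ih ?ihf ?ihg //.
- by apply: eq_forallb => x; rewrite ih env_cons_rename.
- by apply: eq_existsb => x; rewrite ih env_cons_rename.
Qed.

Lemma fo_rename n m (s : 'I_n -> 'I_m) (P : forall G : sgraph, ('I_n -> G) -> Prop) :
  fo P -> fo (fun G (w : 'I_m -> G) => P G (w \o s)).
Proof. by move=> [phi hp]; exists (rename phi s) => G v; rewrite sat_rename. Qed.

Lemma fo_all_ord m : forall n
    (P : forall G : sgraph, ('I_n -> G) -> ('I_m -> G) -> Prop),
  fo (fun G (w : 'I_(m + n) -> G) => P G (w \o @rshift m n) (w \o @lshift m n)) ->
  fo (fun G v => forall p, P G v p).
Proof.
elim: m => [|m ih] n P hP.
  have ev (G : sgraph) (v : 'I_(0 + n) -> G) : v \o @rshift 0 n = v.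
    by apply: funext => i /=; congr v; apply: val_inj.
  apply: fo_ext hP => G v; rewrite ev; split=> [h p|h]; last exact: h.
  by have -> : p = v \o @lshift 0 n by apply: funext; case.
suff hQ : fo (fun G v => forall x p, P G v (env_cons x p)).
  apply: fo_ext hQ => G v; split=> [h p|h x p]; last exact: h.
  have := h (p ord0) (env_tail p).
  congr P; apply: funext => i; rewrite /env_cons /env_tail.
  by case: unliftP => [j ->|->].
apply: (@fo_all n (fun G v x => forall p, P G v (env_cons x p))).
apply: (ih n.+1 (fun G w p => P G (env_tail w) (env_cons (w ord0) p))).
(* Both contexts list the same variables, in a different order. *)
pose s (i : 'I_(m.+1 + n)) : 'I_(m + n.+1) :=
  match split i with
  | inl j => env_cons (rshift m ord0) (@lshift m n.+1) j
  | inr k => rshift m (lift ord0 k)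
  end.
apply: fo_ext (fo_rename s hP) => G w.
suff [-> ->] : (w \o s) \o @rshift m.+1 n = env_tail (w \o @rshift m n.+1) /\
  (w \o s) \o @lshift m.+1 n = env_cons ((w \o @rshift m n.+1) ord0) (w \o @lshift m n.+1) by [].
split; apply: funext => i; rewrite /= /s.
  by rewrite -[rshift m.+1 i]/(unsplit (inr i)) unsplitK.
rewrite -[lshift n i]/(unsplit (inl i)) unsplitK /env_cons.
by case: (unlift ord0 i).
Qed.

(** A quantifier over functions on a finite type is a block of [#|K|] vertex quantifiers; this is
    how a formula quantifies over whole rows of cells. *)
Lemma fo_all_fun (K : finType) n
    (P : forall G : sgraph, ('I_n -> G) -> (K -> G) -> Prop) :
  fo (fun G (w : 'I_(#|K| + n) -> G) =>
        P G (w \o @rshift #|K| n) (fun k => w (lshift n (enum_rank k)))) ->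
  fo (fun G v => forall p, P G v p).
Proof.
move=> hP.
apply: fo_ext (fo_all_ord (P := fun G v p => P G v (p \o enum_rank)) hP) => G v.
split=> h p; last exact: h.
have := h (p \o enum_val).
by congr P; apply: funext => k /=; rewrite enum_rankK.
Qed.

Lemma fo_ex_fun (K : finType) n
    (P : forall G : sgraph, ('I_n -> G) -> (K -> G) -> Prop) :
  fo (fun G (w : 'I_(#|K| + n) -> G) =>
        P G (w \o @rshift #|K| n) (fun k => w (lshift n (enum_rank k)))) ->
  fo (fun G v => exists p, P G v p).
Proof.
move=> hP.
have := fo_not (@fo_all_fun K n (fun G v p => ~ P G v p) (fo_not hP)).
apply: fo_ext => G v.
by split=> [/existsNP[p /contrapT]|[p h1 h2]]; [exists p|apply: h2 h1].
Qed.

Lemma fo_eq_fun (K : finType) n (a b : K -> 'I_n) :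
  fo (fun G v => (fun k => v (a k)) = (fun k => v (b k)) :> (K -> G)).
Proof.
apply: fo_ext (fo_fin_all (fun k => fo_eq (a k) (b k))) => G v.
by split=> [h|h k]; [apply: funext | have := congr1 (@^~ k) h].
Qed.

Ltac fo_step :=
  first [ apply: fo_and | apply: fo_or | apply: fo_not | apply: fo_edge
        | apply: fo_eq | apply: fo_eq_fun
        | apply: fo_all_fun; rewrite /= | apply: fo_ex_fun; rewrite /=
        | apply: fo_all; rewrite /=
        | apply: fo_cst
        | apply: fo_fin_all => ? | apply: fo_fin_ex => ?
        | apply: fo_imp ].

(** * The base expander *)

Local Open Scope ring_scope.

(** * Averages and variance on finite types *)

Section Averages.
Variable R : realFieldType.

Definition avg (I : finType) (f : I -> R) : R := #|I|%:R^-1 * \sum_i f i.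

Lemma eq_avg (I : finType) (f g : I -> R) : f =1 g -> avg f = avg g.
Proof. by move=> fg; rewrite /avg (eq_bigr _ (fun i _ => fg i)). Qed.

Lemma avgD (I : finType) (f g : I -> R) :
  avg (fun i => f i + g i) = avg f + avg g.
Proof. by rewrite /avg big_split mulrDr. Qed.

Lemma avgB (I : finType) (f g : I -> R) :
  avg (fun i => f i - g i) = avg f - avg g.
Proof. by rewrite /avg sumrB mulrBr. Qed.

Lemma sum_avg (I : finType) (f : I -> R) : #|I|%:R * avg f = \sum_i f i.
Proof.
rewrite /avg; have [I0|I0] := eqVneq #|I| 0%N.
  by rewrite I0 mul0r big1 // => i _; have := fintype0 i I0.
by rewrite mulrA divff ?mul1r // pnatr_eq0.
Qed.

Lemma avg_cst (I : finType) (c : R) : (0 < #|I|)%N -> avg (fun _ : I => c) = c.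
Proof.
move=> I0; rewrite /avg sumr_const -[c *+ _]mulr_natl mulrA mulVf ?mul1r //.
by rewrite pnatr_eq0 -lt0n.
Qed.

Lemma avg_reindex (I K : finType) (s : I -> K) (f : K -> R) :
  bijective s -> avg (fun i => f (s i)) = avg f.
Proof.
move=> bs; rewrite /avg (bij_eq_card bs) [in RHS](reindex s) //.
exact: onW_bij.
Qed.

Lemma avg_pair (I K : finType) (f : I * K -> R) :
  avg f = avg (fun i => avg (fun k => f (i, k))).
Proof.
rewrite /avg card_prod natrM invfM -mulrA; congr (_ * _).
rewrite -mulr_sumr pair_bigA /=; congr (_ * _).
by apply: eq_bigr => -[].
Qed.

Lemma avg_exchange (I K : finType) (f : I -> K -> R) :
  avg (fun i => avg (f i)) = avg (fun k => avg (f^~ k)).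
Proof. by rewrite /avg -!mulr_sumr mulrCA exchange_big. Qed.

Lemma sum_sqr_sub_avg (I : finType) (f : I -> R) :
  \sum_i (f i - avg f) ^+ 2 = \sum_i f i ^+ 2 - #|I|%:R * avg f ^+ 2.
Proof.
under eq_bigr => i _ do rewrite sqrrB.
rewrite big_split sumrB /= sumr_const -[avg f ^+ 2 *+ _]mulr_natl.
rewrite sumrMnl -mulr_suml -(sum_avg f); ring.
Qed.

Lemma avg_sqr_le (I : finType) (f : I -> R) :
  #|I|%:R * avg f ^+ 2 <= \sum_i f i ^+ 2.
Proof.
rewrite -subr_ge0 -sum_sqr_sub_avg; apply: sumr_ge0 => i _; exact: sqr_ge0.
Qed.

Lemma sum_eq0_sqr (I : finType) (f : I -> R) :
  \sum_i f i ^+ 2 <= 0 -> forall i, f i = 0.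
Proof.
move=> h i; apply/eqP; rewrite -sqrf_eq0; apply/eqP.
apply: (psumr_eq0P (P := predT) (F := fun i => f i ^+ 2)) => //.
  by move=> j _; exact: sqr_ge0.
apply/eqP; rewrite eq_le h; apply: sumr_ge0 => j _; exact: sqr_ge0.
Qed.

End Averages.

(** * Commuting orthogonal projections whose long products vanish *)

Section CommutingProjections.
Variables (R : realFieldType) (T : finType) (X : eqType).
Variable P : X -> (T -> R) -> T -> R.

Let ip (f g : T -> R) : R := \sum_t f t * g t.

Hypothesis PB : forall x f g,
  P x (fun t => f t - g t) = (fun t => P x f t - P x g t).
Hypothesis PC : forall x y f, P x (P y f) = P y (P x f).
Hypothesis PP : forall x f, P x (P x f) = P x f.
Hypothesis Padj : forall x f g, ip (P x f) g = ip f (P x g).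

Let kills (s : seq X) k f :=
  forall t, subseq t s -> size t = k.+1 -> forall a, foldr P f t a = 0.

Let foldrPB t f g :
  foldr P (fun a => f a - g a) t = (fun a => foldr P f t a - foldr P g t a).
Proof. by elim: t => //= x t ->; rewrite PB. Qed.

Let foldrPC x t f : foldr P (P x f) t = P x (foldr P f t).
Proof. by elim: t => //= y t ->; rewrite PC. Qed.

Let P0 x f : (forall a, f a = 0) -> forall a, P x f a = 0.
Proof.
move=> f0 a; have -> : f = (fun t => f t - f t).
  by apply: funext => t; rewrite subrr f0.
by rewrite PB subrr.
Qed.

Let ipBl f g e : ip (fun a => f a - g a) e = ip f e - ip g e.
Proof. by rewrite /ip -sumrB; apply: eq_bigr => a _; rewrite mulrBl. Qed.

Let ipC f g : ip f g = ip g f.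
Proof. by apply: eq_bigr => a _; rewrite mulrC. Qed.

Let pythagoras x f :
  ip f f = ip (P x f) (P x f) + ip (fun a => f a - P x f a) (fun a => f a - P x f a).
Proof.
have e : ip (P x f) (P x f) = ip f (P x f) by rewrite Padj PP.
set d := fun a => _; have dE g : ip d g = ip f g - ip (P x f) g by exact: ipBl.
by rewrite dE (ipC f d) (ipC (P x f) d) !dE e (ipC (P x f) f); ring.
Qed.

(** In a joint eigenbasis, each vector occurring in [f] would be fixed by at most [k] of the
    projections. Diagonalisation is avoided by induction on [s]: [f] splits orthogonally into
    [P x f], on which any [k] of the remaining projections compose to zero, and [f - P x f], on
    which any [k.+1] still do. *)
Lemma sum_projections_le s k f : kills s k f ->
  \sum_(x <- s) ip (P x f) (P x f) <= k%:R * ip f f.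
Proof.
have ip_ge0 g : 0 <= ip g g.
  by apply: sumr_ge0 => a _; rewrite -expr2 sqr_ge0.
elim: s k f => [|x s ih] k f kf; first by rewrite big_nil mulr_ge0.
rewrite big_cons; set f1 := P x f; pose f0 a := f a - f1 a.
have kf0 : kills s k f0.
  move=> t ts st a; have zt : forall b, foldr P f t b = 0.
    by apply: kf => //; apply: subseq_trans ts (subseq_cons _ _).
  by rewrite foldrPB foldrPC zt (P0 _ zt) subrr.
have h0 := ih _ _ kf0.
have -> : \sum_(y <- s) ip (P y f) (P y f) =
    \sum_(y <- s) ip (P y f1) (P y f1) + \sum_(y <- s) ip (P y f0) (P y f0).
  rewrite -big_split; apply: eq_bigr => y _ /=.
  by rewrite (pythagoras x (P y f)) PB /f1 (PC y x).
rewrite (pythagoras x f) -/f1 -/f0.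
case: k => [|k] in kf kf0 h0 *.
  have f10 : forall a, f1 a = 0 by apply: (kf [:: x]) => //; rewrite sub1seq mem_head.
  have z g : (forall a, g a = 0) -> ip g g = 0.
    by move=> g0; rewrite /ip big1 // => a _; rewrite g0 mul0r.
  rewrite (z _ f10) [X in _ + (X + _)]big1 => [|y _]; last exact: z (P0 _ f10).
  by rewrite !add0r.
have kf1 : kills s k f1.
  move=> t ts st a; rewrite foldrPC; apply: (kf (x :: t)); last by rewrite /= st.
  by rewrite /= eqxx.
have h1 := ih _ _ kf1.
rewrite -natr1 in h0 *; lra.
Qed.

End CommutingProjections.

(** * Averages along lines over a finite field *)

Section Lines.
Variables (F : finFieldType) (n : nat).

Definition moment (x : F) : 'rV[F]_n := \row_(j < n) x ^+ j.

(** Distinct nodes give a nonzero Vandermonde determinant, so the moment vectors form a basis. *)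
Lemma moments_span (t : seq F) (a : 'rV[F]_n) : uniq t -> size t = n ->
  exists y : 'I_n -> F, a = \sum_i y i *: moment (nth 0 t i).
Proof.
move=> ut st.
pose V := (Vandermonde n (\row_(j < n) nth 0 t j))^T : 'M[F]_n.
have uV : V \in unitmx.
  rewrite unitmxE det_tr det_Vandermonde unitfE prodf_seq_neq0.
  apply/allP => i _ /=; rewrite prodf_seq_neq0; apply/allP => j _ /=.
  apply/implyP => ij; rewrite !mxE subr_eq0 nth_uniq ?st //.
  by rewrite eq_sym neq_ltn ij.
exists (fun i => (a *m invmx V) 0 i).
rewrite -[LHS](mulmxKV uV) mulmx_sum_row; apply: eq_bigr => i _.
by congr (_ *: _); apply/rowP => j; rewrite !mxE.
Qed.

Variable R : realFieldType.

Definition line_avg (x : F) (f : 'rV[F]_n -> R) (a : 'rV[F]_n) : R :=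
  avg (fun y : F => f (a + y *: moment x)).

Lemma line_avg_invariant x f a y :
  line_avg x f (a + y *: moment x) = line_avg x f a.
Proof.
rewrite -[RHS](avg_reindex _ (s := fun z => y + z)); last first.
  by exists (fun z => - y + z) => z; rewrite ?addKr ?addNKr.
by apply: eq_avg => z; rewrite scalerDl addrA.
Qed.

Lemma card_field_gt0 : (0 < #|F|)%N.
Proof. by apply/card_gt0P; exists 0. Qed.

Lemma line_avgK x f : line_avg x (line_avg x f) = line_avg x f.
Proof.
apply: funext => a; rewrite -[RHS](avg_cst (I := F) _ card_field_gt0).
by apply: eq_avg => y; exact: line_avg_invariant.
Qed.

Lemma line_avgC x y f : line_avg x (line_avg y f) = line_avg y (line_avg x f).
Proof.
apply: funext => a; rewrite /line_avg /avg -!mulr_sumr exchange_big /=.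
do 2 congr (_ * _); apply: eq_bigr => u _; apply: eq_bigr => v _.
by rewrite addrAC.
Qed.

Lemma sum_shift (f : 'rV[F]_n -> R) b : \sum_a f (a + b) = \sum_a f a.
Proof. by rewrite [RHS](reindex_inj (addIr b)). Qed.

Lemma line_avg_adjoint x f g :
  \sum_a line_avg x f a * g a = \sum_a f a * line_avg x g a.
Proof.
rewrite /line_avg /avg.
under eq_bigr => a _ do rewrite -mulrA mulr_suml.
under [RHS]eq_bigr => a _ do rewrite mulrCA mulr_sumr.
rewrite -!mulr_sumr; congr (_ * _); rewrite exchange_big [RHS]exchange_big /=.
rewrite [RHS](reindex_inj oppr_inj) /=; apply: eq_bigr => y _.
rewrite -[RHS](sum_shift _ (y *: moment x)); apply: eq_bigr => a _.
by rewrite scaleNr addrK.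
Qed.

(** The iterated average is invariant along [n] directions that span the space, hence constant.
    Averaging preserves the total, so the constant is zero. *)
Lemma line_avgs_kill (t : seq F) (f : 'rV[F]_n -> R) : uniq t -> size t = n ->
  \sum_a f a = 0 -> forall a, foldr line_avg f t a = 0.
Proof.
move=> ut st f0; set g := foldr _ _ _.
have ginv x : x \in t -> line_avg x g = g.
  rewrite /g; elim: (t) => //= y s ih; rewrite in_cons.
  by have [-> _|_ /= /ih e] := eqVneq; rewrite ?line_avgK // line_avgC e.
have gcst a : g a = g 0.
  have [y ->] := moments_span a ut st.
  elim/big_rec: _ => [//|i b _ <-].
  by rewrite addrC -(ginv (nth 0 t i)) ?line_avg_invariant // mem_nth ?st.
have sg : \sum_a g a = 0.
  rewrite /g; elim: (t) => //= x s ih; rewrite -[RHS]ih.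
  transitivity (\sum_a line_avg x (foldr line_avg f s) a * (fun=> 1) a).
    by apply: eq_bigr => a _; rewrite mulr1.
  rewrite line_avg_adjoint; apply: eq_bigr => a _.
  by rewrite /line_avg avg_cst ?mulr1 // card_field_gt0.
move=> a; rewrite gcst; move: sg; rewrite (eq_bigr _ (fun b _ => gcst b)).
rewrite sumr_const => /eqP; rewrite mulrn_eq0 => /orP[|/eqP //].
by rewrite eqn0Ngt (introT card_gt0P) //; exists 0.
Qed.

End Lines.

(** The walk is the mean over [x] of the projections [line_avg x]. Convexity of the square bounds
    its squared norm by the mean of their squared norms, and any [n.+1] distinct projections kill
    [f]. *)
Lemma lines_contract (F : finFieldType) (n : nat) (R : realFieldType)
    (f : 'rV[F]_n.+1 -> R) : \sum_a f a = 0 ->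
  \sum_a avg (fun j : F * F => f (a + j.2 *: moment n.+1 j.1)) ^+ 2 <=
    n%:R / #|F|%:R * \sum_a f a ^+ 2.
Proof.
move=> f0.
have kf t : subseq t (enum F) -> size t = n.+1 ->
    forall a, foldr (@line_avg F n.+1 R) f t a = 0.
  by move=> ts st; apply: line_avgs_kill => //; apply: subseq_uniq ts (enum_uniq _).
have PB x g1 g2 : line_avg x (fun a : 'rV[F]_n.+1 => g1 a - g2 a) =
    (fun a => line_avg x g1 a - line_avg x g2 a :> R).
  by apply: funext => a; rewrite /line_avg avgB.
have := sum_projections_le PB (@line_avgC _ _ _) (@line_avgK _ _ _)
  (@line_avg_adjoint _ _ _) kf.
rewrite big_enum /= => h.
have F0 : (0 : R) < #|F|%:R by rewrite ltr0n card_field_gt0.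
have {h} h : \sum_x \sum_a line_avg x f a ^+ 2 <= n%:R * \sum_a f a ^+ 2.
  by under [leLHS]eq_bigr do under eq_bigr do rewrite expr2;
  under [X in _ * X]eq_bigr do rewrite expr2.
rewrite mulrAC ler_pdivlMr //; apply: le_trans h.
rewrite exchange_big mulr_suml /=; apply: ler_sum => a _.
rewrite mulrC avg_pair; exact: avg_sqr_le.
Qed.

Lemma base_expander : exists (J B : finType) (h : J -> B -> B)
    (beta : B -> (J * J) * (J * J)),
  [/\ forall j, injective (h j), bijective beta, (4 <= #|B|)%N, (0 < #|J|)%N
    & forall (R : realFieldType) (f : B -> R), \sum_a f a = 0 ->
      \sum_a avg (fun j => f (h j a)) ^+ 2 <= 9%:R^-1 * \sum_a f a ^+ 2].
Proof.
(* The contraction factor will be [7 / #|F|], and 67 is the least prime for which this is at most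
   [1/9]. *)
have [F cF] : exists F : finFieldType, #|F| = 67%N.
  by exists 'F_67; rewrite card_Fp.
have cJ : #|{: F * F}| = (67 * 67)%N by rewrite card_prod cF.
(* Dimension 8 makes the points of [B] as many as the pairs of labels in [J * J] for [J = F * F];
   any enumeration then supplies [beta]. *)
have eB : #|'rV[F]_8| = #|{: ((F * F) * (F * F)) * ((F * F) * (F * F))}|.
  by rewrite card_mx mul1n !card_prod -!mulnA.
exists (F * F)%type, 'rV[F]_8, (fun j a => a + j.2 *: moment 8 j.1),
  (fun a => enum_val (cast_ord eB (enum_rank a))).
split.
- by move=> j; exact: addIr.
- exists (fun b => enum_val (cast_ord (esym eB) (enum_rank b))) => a;
  by rewrite enum_valK ?cast_ordK ?cast_ordKV enum_rankK.
- by rewrite card_mx mul1n cF; apply: leq_trans (leq_pexp2l _ (_ : 1 <= 8)%N).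
- by rewrite cJ.
move=> R f /lines_contract/le_trans; apply; apply: ler_wpM2r.
  by apply: sumr_ge0 => a _; exact: sqr_ge0.
by rewrite cF ler_pdivrMr ?ltr0n // ler_pdivlMl ?ltr0n //; lra.
Qed.

(** * Towers *)

Section ZigZag.
Variables (J B : finType) (h : J -> B -> B) (beta : B -> (J * J) * (J * J)).
Hypothesis h_inj : forall j, injective (h j).
Hypothesis beta_bij : bijective beta.
Hypothesis card_B : (4 <= #|B|)%N.
Hypothesis card_J : (0 < #|J|)%N.
Hypothesis h_contract : forall (R : realFieldType) (f : B -> R), \sum_a f a = 0 ->
  \sum_a avg (fun j => f (h j a)) ^+ 2 <= 9%:R^-1 * \sum_a f a ^+ 2.

Lemma avg_step (R : realFieldType) (f : B -> R) :
  avg (fun a => avg (fun j => f (h j a))) = avg f.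
Proof.
rewrite avg_exchange -[RHS](avg_cst (I := J) _ card_J).
by apply: eq_avg => j; apply: avg_reindex; apply: injF_bij.
Qed.

(** The constant part of [f] is preserved by a step, and the mean-zero part shrinks by [1/9] in
    squared norm. *)
Lemma step_norm (R : realFieldType) (f : B -> R) :
  \sum_a avg (fun j => f (h j a)) ^+ 2 <=
  #|B|%:R * avg f ^+ 2 + 9%:R^-1 * (\sum_a f a ^+ 2 - #|B|%:R * avg f ^+ 2).
Proof.
have f0 : \sum_a (f a - avg f) = 0.
  by rewrite sumrB sumr_const -[avg f *+ _]mulr_natl sum_avg subrr.
have := h_contract f0; rewrite sum_sqr_sub_avg.
under eq_bigr => a _ do rewrite avgB avg_cst //.
rewrite -{1}avg_step sum_sqr_sub_avg avg_step; lra.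
Qed.

(** Under the hypothesis, averaging [p] over [j] loses no norm, which the contraction allows only
    when the variance of [p] is zero. It will show that a closed set of a tower contains all
    siblings of its non-root members. *)
Lemma step_connected (p : B -> bool) :
  (forall j j' c, p (h j c) = p (h j' c)) -> forall a b, p a = p b.
Proof.
move=> ph; have /card_gt0P [j0 _] := card_J.
pose f a : rat := (p a)%:R.
suff e a : f a = avg f.
  move=> a b; have : f a == f b by rewrite !e.
  by rewrite /f eqr_nat; case: (p a) (p b) => [] [].
apply/eqP; rewrite -subr_eq0; apply/eqP; move: a.
apply: (@sum_eq0_sqr _ _ (fun a => f a - avg f)).
rewrite sum_sqr_sub_avg; have := step_norm f.
have -> : \sum_a avg (fun j => f (h j a)) ^+ 2 = \sum_a f a ^+ 2.
  rewrite [RHS](reindex_inj (@h_inj j0)); apply: eq_bigr => a _.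
  rewrite -[f (h j0 a)](avg_cst (I := J) _ card_J); congr (_ ^+ 2).
  by apply: eq_avg => j; rewrite /f (ph j j0).
lra.
Qed.

(** * Spectral contraction of the zig-zag product *)

Section Contraction.
Variables (R : realFieldType) (V : finType) (pi : J * J -> V -> V).
Hypothesis pi_inj : forall i, injective (pi i).

Definition pi2 (k : (J * J) * (J * J)) (v : V) : V := pi k.2 (pi k.1 v).

Lemma pi2_inj k : injective (pi2 k).
Proof. by move=> v w /pi_inj /pi_inj. Qed.

Variable F : V -> B -> R.
Let g v := avg (F v).

(** [F v] is a function on the cloud of [v], and [g] collects the cloud means. The first inner step
    shrinks the deviation from the means, the shuffle keeps norms, and the second inner step damps
    all but the new cloud means. With [X] the squared norm of the mean part and [D] that of the
    deviation, the result is at most [2/9 X + 17/81 D], below a quarter of [X + D]. *)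
Lemma zigzag_contract :
  16%:R * \sum_v avg (fun k => g (pi2 k v)) ^+ 2 <= \sum_v g v ^+ 2 ->
  4%:R * (\sum_v \sum_a
     avg (fun i => avg (fun j => F (pi2 (beta (h i a)) v) (h j (h i a)))) ^+ 2) <=
  \sum_v \sum_a F v a ^+ 2.
Proof.
move=> hg.
pose Q v a := avg (fun j => F v (h j a)).
pose q v a := Q (pi2 (beta a) v) a.
(* For fixed [a] the shuffle permutes the vertices [v], so it preserves sums. *)
have reidx (f : V -> B -> R) :
    \sum_v \sum_a f (pi2 (beta a) v) a = \sum_v \sum_a f v a.
  rewrite exchange_big [RHS]exchange_big /=; apply: eq_bigr => a _.
  by rewrite [RHS](reindex_inj (@pi2_inj (beta a))).
have sumstep (f : V -> B -> R) : \sum_v \sum_a avg (fun i => f v (h i a)) ^+ 2 <=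
    #|B|%:R * \sum_v avg (f v) ^+ 2 +
    9%:R^-1 * (\sum_v \sum_a f v a ^+ 2 - #|B|%:R * \sum_v avg (f v) ^+ 2).
  rewrite !mulr_sumr -sumrB mulr_sumr -big_split /=.
  by apply: ler_sum => v _; exact: step_norm.
have N1 : \sum_v \sum_a Q v a ^+ 2 <= #|B|%:R * \sum_v g v ^+ 2 +
    9%:R^-1 * (\sum_v \sum_a F v a ^+ 2 - #|B|%:R * \sum_v g v ^+ 2) by exact: sumstep.
have N2 : \sum_v \sum_a q v a ^+ 2 = \sum_v \sum_a Q v a ^+ 2.
  exact: (reidx (fun v a => Q v a ^+ 2)).
have N3 := sumstep q; rewrite N2 in N3.
have N5 : \sum_v \sum_a (Q v a - g v) ^+ 2 =
    \sum_v \sum_a Q v a ^+ 2 - #|B|%:R * \sum_v g v ^+ 2.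
  rewrite mulr_sumr -sumrB; apply: eq_bigr => v _.
  by rewrite -[g v]/(avg (F v)) -(avg_step (F v)) -sum_sqr_sub_avg.
(* Since [beta] is bijective, a cloud mean after the shuffle is a step of [g] on the squared graph
   plus a mean of deviations; the square of the sum is at most twice the sum of the squares. *)
have N4 : #|B|%:R * \sum_v avg (q v) ^+ 2 <=
    2%:R * (#|B|%:R * \sum_v avg (fun k => g (pi2 k v)) ^+ 2) +
    2%:R * \sum_v \sum_a (Q v a - g v) ^+ 2.
  rewrite -(reidx (fun v a => (Q v a - g v) ^+ 2)) !mulr_sumr -big_split /=.
  apply: ler_sum => v _.
  have -> : avg (q v) = avg (fun k => g (pi2 k v)) +
      avg (fun a => Q (pi2 (beta a) v) a - g (pi2 (beta a) v)).
    rewrite -(avg_reindex (fun k => g (pi2 k v)) beta_bij) -avgD.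
    by apply: eq_avg => a; rewrite /q addrC subrK.
  set x := avg _; set y := avg _.
  have hy : #|B|%:R * y ^+ 2 <=
      \sum_a (Q (pi2 (beta a) v) a - g (pi2 (beta a) v)) ^+ 2 by exact: avg_sqr_le.
  have : #|B|%:R * (x + y) ^+ 2 <= #|B|%:R * (2%:R * x ^+ 2 + 2%:R * y ^+ 2).
    by apply: ler_wpM2l => //; have := sqr_ge0 (x - y); rewrite sqrrB sqrrD; lra.
  rewrite mulr_sumr; move: hy; rewrite -mulr_sumr; lra.
have hg' : 16%:R * (#|B|%:R * \sum_v avg (fun k => g (pi2 k v)) ^+ 2) <=
    #|B|%:R * \sum_v g v ^+ 2.
  by rewrite mulrCA ler_wpM2l.
have N6 : #|B|%:R * \sum_v g v ^+ 2 <= \sum_v \sum_a F v a ^+ 2.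
  by rewrite mulr_sumr; apply: ler_sum => v _; exact: avg_sqr_le.
rewrite -[X in 4%:R * X]/(\sum_v \sum_a avg (fun i => q v (h i a)) ^+ 2).
have N7 : 0 <= #|B|%:R * \sum_v g v ^+ 2.
  by rewrite mulr_ge0 // sumr_ge0 // => v _; exact: sqr_ge0.
move: N1 N3 N4 hg' N6 N7; rewrite N5.
set SQ := \sum_v \sum_a Q v a ^+ 2; set X := #|B|%:R * \sum_v g v ^+ 2.
set SF := \sum_v \sum_a F v a ^+ 2; set M2 := #|B|%:R * \sum_v avg (fun k => _) ^+ 2.
set Sq := #|B|%:R * \sum_v avg (q v) ^+ 2; set Z := \sum_v \sum_a avg (fun i => _) ^+ 2.
move: SQ X SF M2 Sq Z => {}SQ {}X {}SF {}M2 {}Sq {}Z; lra.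
Qed.

End Contraction.

(** * Levels, spectral gap and expansion of a tower *)

Section Tower.
Variables (V : finType) (r : V) (I : {set V}).
Variables (pi : J * J -> V -> V) (ch : V -> B -> V).
Hypothesis pi_inj : forall i, injective (pi i).
Hypothesis piI : forall i v, (pi i v \in I) = (v \in I).
Hypothesis ch_inj : forall v v' b b', v \in I -> v' \in I ->
  ch v b = ch v' b' -> v = v' /\ b = b'.
Hypothesis ch_neq_root : forall v b, v \in I -> ch v b != r.
Hypothesis ch_surj : forall w, w != r -> exists2 v, v \in I & exists b, w = ch v b.
Hypothesis pi_ch : forall i j v a, v \in I ->
  pi (i, j) (ch v a) = ch (pi2 pi (beta (h i a)) v) (h j (h i a)).

Lemma pi2I k v : (pi2 pi k v \in I) = (v \in I).
Proof. by rewrite /pi2 !piI. Qed.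

(** An injection of a finite set into itself is onto. *)
Lemma closed_pi (A : {set V}) i : (forall v, v \in A -> pi i v \in A) ->
  forall v, (pi i v \in A) = (v \in A).
Proof.
move=> hA v; apply/idP/idP; last exact: hA.
have e : pi i @: A = A.
  apply/eqP; rewrite eqEcard card_imset // leqnn andbT.
  by apply/subsetP => _ /imsetP [w wA ->]; exact: hA.
by rewrite -{1}e => /imsetP [w wA /pi_inj ->].
Qed.

(** The non-root vertices are exactly the children, and [pi] sends children to children; so the
    complement, which is the root alone, is preserved too. *)
Lemma pi_root i : pi i r = r.
Proof.
have hA v : v \in [set~ r] -> pi i v \in [set~ r].
  rewrite !inE => /ch_surj [u uI [b ->]]; case: i => i j.
  by rewrite pi_ch // ch_neq_root // pi2I.
by have := closed_pi hA r; rewrite !inE eqxx => /negbFE /eqP.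
Qed.

Fixpoint lev k : {set V} :=
  if k is k'.+1 then [set ch x.1 x.2 | x in setX (lev k' :&: I) [set: B]]
  else [set r].

Lemma levSP k w :
  reflect (exists v b, [/\ v \in lev k, v \in I & w = ch v b]) (w \in lev k.+1).
Proof.
apply: (iffP imsetP) => [[[v b]]|[v [b [vk vI ->]]]].
  by rewrite !inE andbT => /andP[vk vI] ->; exists v, b.
by exists (v, b); rewrite // !inE vk vI.
Qed.

Lemma lev_pi k i v : (pi i v \in lev k) = (v \in lev k).
Proof.
elim: k i v => [|k ih] i v.
  by rewrite !inE -{1}(pi_root i) (inj_eq (@pi_inj i)).
apply: closed_pi => {}v /levSP [u [b [uk uI ->]]]; case: i => i j.
rewrite pi_ch //; apply/levSP; do 2 eexists; split; last reflexivity.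
  by rewrite /pi2 !ih.
by rewrite pi2I.
Qed.

Lemma ch_lev k v b : v \in I -> (ch v b \in lev k.+1) = (v \in lev k).
Proof.
move=> vI; apply/levSP/idP => [[u [c [uk uI /ch_inj[] // -> //]]]|vk].
by exists v, b.
Qed.

Lemma sum_children (R : realFieldType) (f : V -> R) :
  \sum_w f w = f r + \sum_(v in I) \sum_b f (ch v b).
Proof.
have e : [set~ r] = [set ch x.1 x.2 | x in setX I [set: B]].
  apply/setP => w; rewrite !inE; apply/idP/imsetP.
    by move=> /ch_surj [v vI [b ->]]; exists (v, b); rewrite // !inE vI.
  by move=> [[v b]]; rewrite !inE andbT => vI ->; exact: ch_neq_root.
have ce : {in setX I [set: B] &, injective (fun x => ch x.1 x.2)}.
  move=> [v b] [v' b']; rewrite !inE !andbT => vI vI' /ch_inj.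
  by move=> /(_ vI vI') /= [-> ->].
rewrite (bigD1 r) //=; congr (_ + _).
rewrite (eq_bigl (fun w => w \in [set~ r])); last by move=> w; rewrite !inE.
rewrite e big_imset //= pair_big_dep /=.
by apply: eq_bigl => x; rewrite !inE.
Qed.

Definition walk (R : realFieldType) (f : V -> R) (v : V) : R :=
  avg (fun i => f (pi i v)).

Lemma avg_pi2 (R : realFieldType) (f : V -> R) v :
  avg (fun k => f (pi2 pi k v)) = walk (walk f) v.
Proof. exact: avg_pair. Qed.

Lemma sum_walk (R : realFieldType) (f : V -> R) : \sum_v walk f v = \sum_v f v.
Proof.
have J0 : (0 < #|{: J * J}|)%N by rewrite card_prod muln_gt0 card_J.
rewrite /walk /avg -mulr_sumr exchange_big /=.
rewrite (eq_bigr (fun=> \sum_v f v)) => [|i _]; last first.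
  by rewrite [RHS](reindex_inj (@pi_inj i)).
by rewrite -/(avg (fun=> \sum_v f v)) avg_cst.
Qed.

(** Level [k.+1] is the zig-zag product of the square of level [k] with the base expander, so the
    bound passes from one level to the next. *)
Lemma lev_gap (R : realFieldType) k (f : V -> R) :
  (forall v, v \notin lev k -> f v = 0) -> \sum_v f v = 0 ->
  4%:R * \sum_v walk f v ^+ 2 <= \sum_v f v ^+ 2.
Proof.
elim: k f => [|k ih] f fk f0.
  have fr : f r = 0.
    by rewrite -f0 (bigD1 r) //= big1 ?addr0 // => v vr; rewrite fk // !inE.
  have z v : f v = 0.
    by have [->//|vr] := eqVneq v r; rewrite fk // !inE.
  have zw v : walk f v = 0.
    by rewrite /walk /avg big1 ?mulr0 // => i _; exact: z.
  by rewrite !big1 ?mulr0 // => v _; rewrite ?z ?zw expr0n.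
have fr : f r = 0.
  by apply: fk; apply/levSP => -[v [b [_ vI e]]]; have := ch_neq_root b vI; rewrite -e eqxx.
(* Extending by zero over the leaves lets the zig-zag estimate run over all of [V]. *)
pose F v a := if v \in I then f (ch v a) else 0.
pose g v := avg (F v).
have Fk v a : v \notin lev k -> F v a = 0.
  by rewrite /F; case: ifP => // vI vk; rewrite fk // ch_lev.
have gk v : v \notin lev k -> g v = 0.
  by move=> vk; rewrite /g /avg big1 ?mulr0 // => a _; exact: Fk.
have sumF (e : R -> R) : e 0 = 0 -> \sum_w e (f w) = \sum_v \sum_a e (F v a).
  move=> e0; rewrite sum_children fr e0 add0r big_mkcond /=.
  apply: eq_bigr => v _; rewrite /F; case: ifP => // _.
  by rewrite big1.
have g0 : \sum_v g v = 0.
  have B0 : #|B|%:R != 0 :> R by rewrite pnatr_eq0 -lt0n; apply: leq_trans card_B.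
  apply: (mulfI B0); rewrite mulr0 mulr_sumr -[RHS]f0 (sumF id) //.
  by apply: eq_bigr => v _; exact: sum_avg.
have wk v : v \notin lev k -> walk g v = 0.
  by move=> vk; rewrite /walk /avg big1 ?mulr0 // => i _; rewrite gk ?lev_pi.
(* Applied to [g] and then to [walk g], the induction hypothesis yields the factor 16 for the
   squared graph. *)
have h1 := ih g gk g0.
have h2 := ih (walk g) wk (etrans (sum_walk g) g0).
have e2 : \sum_v avg (fun k => avg (F (pi2 pi k v))) ^+ 2 =
    \sum_v walk (walk g) v ^+ 2.
  by apply: eq_bigr => v _; rewrite -avg_pi2.
have zz := zigzag_contract pi_inj (F := F); rewrite e2 in zz.
rewrite (sumF (fun x => x ^+ 2)) ?expr0n //; apply: le_trans (zz _).
  rewrite ler_pM2l // sum_children.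
  have -> : walk f r = 0.
    by rewrite /walk /avg big1 ?mulr0 // => i _; rewrite pi_root.
  rewrite expr0n add0r big_mkcond /=; apply: ler_sum => v _; case: ifP => vI; last first.
    by apply: sumr_ge0 => a _; exact: sqr_ge0.
  apply: ler_sum => a _; rewrite /walk avg_pair.
  rewrite le_eqVlt; apply/orP; left; apply/eqP; congr (_ ^+ 2).
  by apply: eq_avg => i; apply: eq_avg => j; rewrite pi_ch // /F pi2I vI.
by move: h1 h2; lra.
Qed.

(* The parents of a [pi]-invariant set are only invariant under walks of even
   length, so the induction runs over sequences of sets. *)
Lemma lev_sub_closed (A : nat -> {set V}) :
  (forall n i v, (pi i v \in A n) = (v \in A n.+1)) -> A 0%N != set0 ->
  exists k, lev k != set0 /\ lev k \subset A 0%N.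
Proof.
have [m] := ubnP #|A 0%N|; elim: m A => // m ih A Am hA A0.
have /card_gt0P [j0 _] := card_J.
have /card_gt0P [b0 _] : (0 < #|B|)%N by apply: leq_trans card_B.
have [rA|rA] := boolP (r \in A 0%N).
  exists 0%N; split; first by apply/set0Pn; exists r; rewrite inE.
  by rewrite sub1set.
have rAn n : r \notin A n.
  by elim: n => // n; rewrite -(hA n (j0, j0)) pi_root.
have /all_sig [hV hVK] : forall j, {h' | cancel h' (h j)}.
  move=> j; exists (invF (@h_inj j)); exact: f_invF.
(* The siblings [ch w (h j c)], for all [j], are images of one and the same vertex under the
   permutations [pi (j0, j)]. *)
have key n j c w : w \in I -> (ch w (h j c) \in A n) = (ch w (h j0 c) \in A n).
  move=> wI; pose v := invF (@pi2_inj _ _ pi_inj (beta c)) w.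
  have vw : pi2 pi (beta c) v = w by exact: f_invF.
  have vI : v \in I by rewrite -(pi2I (beta c)) vw.
  have e j' : ch w (h j' c) = pi (j0, j') (ch v (hV j0 c)).
    by rewrite pi_ch // hVK vw.
  by rewrite !e !hA.
pose g n w := ch w b0 \in A n.
have gE n w b : w \in I -> (ch w b \in A n) = g n w.
  move=> wI; apply: (@step_connected (fun b => ch w b \in A n)) => j j' c.
  by rewrite key // [RHS]key.
have gS n v k : v \in I -> g n (pi2 pi k v) = g n.+1 v.
  case: beta_bij => beta' _ betaK vI.
  rewrite -(gE n _ (h j0 (beta' k))) ?pi2I // -(gE n.+1 _ (hV j0 (beta' k))) //.
  by rewrite -(hA n (j0, j0)) pi_ch // hVK betaK.
pose k0 := (j0, j0).
(* One [pi]-move of children is a two-step move of their parents, so each index of [A] becomes two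
   of [A']. The odd members are halfway sets, defined through the fixed label [k0]. *)
pose A' m := [set v in I | g m./2 (if odd m then pi k0 v else v)].
have hA' n i v : (pi i v \in A' n) = (v \in A' n.+1).
  rewrite !inE piI; case vI: (v \in I) => //=; rewrite uphalf_half.
  case on: (odd n) => /=; last first.
    rewrite add0n; pose u := invF (@pi_inj k0) v.
    have uv : pi k0 u = v by exact: f_invF.
    have uI : u \in I by rewrite -(piI k0) uv.
    by rewrite -uv (gS _ _ (k0, i)) ?(gS _ _ (k0, k0)).
  by rewrite add1n -(gS _ _ (i, k0)).
have sub v b : v \in A' 0%N -> ch v b \in A 0%N.
  by rewrite inE => /andP[vI]; rewrite gE.
have /set0Pn [w wA] := A0.
have A'0 : A' 0%N != set0.
  have /ch_surj [v vI [b e]] : w != r by apply: contraNneq rA => <-.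
  by apply/set0Pn; exists v; rewrite inE vI /= -(gE _ _ b) // -e.
(* [A 0] contains all of the at least four children of every member of [A' 0], so the induction on
   cardinality descends. *)
have lt : (#|A' 0%N| < m)%N.
  have ss : [set ch x.1 x.2 | x in setX (A' 0%N) [set: B]] \subset A 0%N.
    by apply/subsetP => _ /imsetP [[v b] /[!inE]/= /andP[vA _] ->]; apply: sub; rewrite inE.
  have := subset_leq_card ss; rewrite card_in_imset; last first.
    move=> [v b] [v' b']; rewrite !inE !andbT => /andP[vI _] /andP[vI' _] /ch_inj.
    by move=> /(_ vI vI') /= [-> ->].
  rewrite cardsX cardsT; move: A'0; rewrite -card_gt0; nia.
have [k [k0' ks]] := ih A' lt hA' A'0.
exists k.+1; split.
  have /set0Pn [v vk] := k0'; apply/set0Pn; exists (ch v b0).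
  by rewrite ch_lev //; have := subsetP ks v vk; rewrite inE => /andP[].
by apply/subsetP => _ /levSP [v [b [vk _ ->]]]; apply: sub; apply: (subsetP ks).
Qed.

(** The set of leaves is invariant and contains a nonempty level [n], after which all levels are
    empty. The remaining leaves are again invariant; if there were any, they would contain a
    nonempty level [j], and each of [j < n], [j > n] and [j = n] is contradictory. *)
Lemma leaves_lev : exists n, ~: I = lev n.
Proof.
have closed_lev (A : {set V}) : (forall i v, (pi i v \in A) = (v \in A)) ->
    A != set0 -> exists k, lev k != set0 /\ lev k \subset A.
  by move=> hA A0; apply: (@lev_sub_closed (fun=> A)).
have next k : lev k \subset ~: I -> lev k.+1 = set0.
  move=> kL; apply/setP => w; rewrite in_set0; apply/negP => /levSP.
  by move=> [v [b [vk vI _]]]; have := subsetP kL v vk; rewrite inE vI.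
have late k k' : lev k.+1 = set0 -> (k < k')%N -> lev k' = set0.
  move=> k0; elim: k' => // k' ihk; rewrite ltnS leq_eqVlt.
  move=> /orP[/eqP <- //|/ihk e]; apply/setP => w; rewrite in_set0.
  by apply/negP => /levSP [v [b []]]; rewrite e inE.
have [||n [n0 nL]] := closed_lev (~: I).
- by move=> i v; rewrite !inE piI.
(* Without leaves, counting children would give [#|V| = 1 + #|B| * #|V|]. *)
- apply/negP => /eqP L0.
  have := @sum_children rat (fun=> 1); rewrite !sumr_const.
  rewrite (_ : #|I| = #|V|); last by rewrite -[I]setCK L0 setC0 cardsT.
  rewrite -mulrnA nat1r => /eqP; rewrite eqr_nat => /eqP e0.
  have e : #|V| = (#|B| * #|V|).+1 := e0.
  have := leq_mul card_B (leqnn #|V|). lia.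
exists n; apply/eqP; rewrite eqEsubset nL andbT -setD_eq0.
apply/negPn/negP => /closed_lev [|j [j0 jL]].
  by move=> i v; rewrite !in_setD lev_pi !inE piI.
have jI : lev j \subset ~: I by apply: subset_trans jL (subsetDl _ _).
have [jn|nj|e] := ltngtP j n.
- by move: n0; rewrite (late _ _ (next _ jI) jn) eqxx.
- by move: j0; rewrite (late _ _ (next _ nL) nj) eqxx.
have /set0Pn [v vj] := j0.
by have := subsetP jL v vj; rewrite !inE -e vj.
Qed.

(** Internal vertices of [S] have at least four children each, so few tree edges leave [S] only if
    [S] has many leaves: three quarters of [#|S|] is at most [s + t/4], with [s] the number of
    leaves in [S]. The gap on the leaf level gives [s <= 6 e], whence the constant 8. *)
Lemma tower_expansion (S : {set V}) : (2 * #|S| <= #|V|)%N ->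
  (#|S| <= 8 * (\sum_v \sum_i ((v \in S) != (pi i v \in S)) +
                \sum_(v in I) \sum_b ((v \in S) != (ch v b \in S))))%N.
Proof.
move=> S2; have [n Ln] := leaves_lev.
set e := (\sum_v _)%N; set t := (\sum_(v in I) _)%N.
pose L v : rat := (v \notin I)%:R; pose chi v : rat := (v \in S)%:R.
pose phi v := chi v * L v; pose s := \sum_v phi v; pose l := \sum_v L v.
have Lpi i v : L (pi i v) = L v by rewrite /L piI.
have LL v : L v * L v = L v by rewrite /L; case: (v \in I); rewrite /= ?mulr0 ?mulr1.
have chi2 v : chi v * chi v = chi v by rewrite /chi; case: (v \in S); rewrite ?mulr0 ?mulr1.
have natE : forall A : {set V}, \sum_v ((v \in A)%:R : rat) = #|A|%:R.
  move=> A; rewrite -sum1_card natr_sum [RHS]big_mkcond /=.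
  by apply: eq_bigr => v _; case: ifP.
have hI : \sum_(v in I) chi v + s = #|S|%:R.
  rewrite -natE /s big_mkcond -big_split; apply: eq_bigr => v _.
  by rewrite /phi /L /chi; case: (v \in I); rewrite /= ?mulr0 ?mulr1 ?addr0 ?add0r.
have hl : l + #|I|%:R = #|V|%:R.
  rewrite -cardsT -!natE /l -big_split; apply: eq_bigr => v _.
  by rewrite /L in_setT; case: (v \in I).
have hV : #|V|%:R = 1 + #|B|%:R * #|I|%:R :> rat.
  have := @sum_children rat (fun=> 1); rewrite !sumr_const -mulrnA => e0.
  by rewrite -natrM; exact: e0.
have B4 : 4 * #|I|%:R <= #|B|%:R * #|I|%:R :> rat.
  by rewrite ler_wpM2r // ler_nat.
have ht : #|B|%:R * \sum_(v in I) chi v <= #|S|%:R + t%:R :> rat.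
  have -> : #|S|%:R = chi r + \sum_(v in I) \sum_b chi (ch v b).
    by rewrite -sum_children natE.
  rewrite /t natr_sum -addrA -big_split mulr_sumr -[leLHS]add0r /=.
  rewrite lerD ?ler0n //; apply: ler_sum => v vI.
  rewrite natr_sum -big_split /= mulr_natl -sumr_const; apply: ler_sum => b _.
  by rewrite /chi; case: (v \in S); case: (ch v b \in S).
have B4' : 4 * \sum_(v in I) chi v <= #|B|%:R * \sum_(v in I) chi v :> rat.
  by rewrite ler_wpM2r ?ler_nat // sumr_ge0.
have l0 : 0 < l.
  have : 0 <= #|I|%:R :> rat by []. 
  lra.
pose c := s / l.
have sl : c * l = s by rewrite /c divfK // gt_eqF.
have s0 : 0 <= s by apply: sumr_ge0 => v _; rewrite mulr_ge0.
have sS : s <= #|S|%:R by rewrite -hI lerDr sumr_ge0.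
have S2' : 2 * #|S|%:R <= #|V|%:R :> rat by rewrite -natrM ler_nat.
(* [S] has at most half of the vertices, and the leaves are more than three quarters of them. *)
have c23 : c * s <= 2 / 3 * s.
  by rewrite ler_wpM2r // /c ler_pdivrMr //; lra.
(* This is the mean-zero part of the indicator of the leaves in [S], to which [lev_gap] applies. *)
pose f v := phi v - c * L v.
have fn v : v \notin lev n -> f v = 0.
  by rewrite -Ln inE negbK => vI; rewrite /f /phi /L vI !mulr0 subr0.
have f0 : \sum_v f v = 0 by rewrite sumrB -mulr_sumr -/s -/l sl subrr.
have gap := lev_gap fn f0.
have f2 : \sum_v f v ^+ 2 = s - c * s.
  transitivity (\sum_v (phi v - 2 * c * phi v + c * c * L v)).
    apply: eq_bigr => v _; rewrite /f /phi.
    transitivity (chi v * chi v * (L v * L v) - 2 * c * (chi v * (L v * L v))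
      + c * c * (L v * L v)); first by ring.
    by rewrite LL chi2; ring.
  rewrite big_split sumrB /= -!mulr_sumr -/s -/l -[c * c * l]mulrA sl; ring.
have wphi v : walk phi v = walk f v + c * L v.
  rewrite -[c * L v](avg_cst (I := (J * J)%type)); last by rewrite card_prod muln_gt0 card_J.
  by rewrite /walk -avgD; apply: eq_avg => i; rewrite /f Lpi subrK.
have Lw v : L v * walk f v = walk f v.
  rewrite /L; case vI: (v \in I); rewrite ?mul1r // mul0r.
  by rewrite /walk /avg big1 ?mulr0 // => i _; rewrite fn // lev_pi -Ln inE vI.
have hE : \sum_v phi v * (1 - walk phi v) = s - c * s - \sum_v f v * walk f v.
  have w0 : \sum_v walk f v = 0 by rewrite sum_walk.
  have -> : s - c * s - \sum_v f v * walk f v =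
      \sum_v (phi v - c * phi v - f v * walk f v) - c * \sum_v walk f v.
    by rewrite w0 mulr0 subr0 !sumrB -mulr_sumr.
  rewrite mulr_sumr -sumrB; apply: eq_bigr => v _; rewrite wphi.
  have pL : phi v * L v = phi v by rewrite /phi -mulrA LL.
  have -> : f v * walk f v = phi v * walk f v - c * walk f v.
    by rewrite mulrBl -[c * L v * _]mulrA Lw.
  transitivity (phi v - phi v * walk f v - c * (phi v * L v)); first by ring.
  by rewrite pL; ring.
(* The inequality [x y <= x^2/4 + y^2] is balanced for a walk that halves norms. *)
have hfw : \sum_v f v * walk f v <= 2^-1 * (s - c * s).
  apply: le_trans (_ : \sum_v (4^-1 * f v ^+ 2 + walk f v ^+ 2) <= _).
    apply: ler_sum => v _; have := sqr_ge0 (2^-1 * f v - walk f v).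
    by rewrite sqrrB exprMn; lra.
  rewrite big_split /= -mulr_sumr f2; rewrite f2 in gap; lra.
(* The form averages over labels the number of leaves of [S] led out of [S]; an average of
   nonnegative terms is at most their sum. *)
have he : \sum_v phi v * (1 - walk phi v) <= e%:R.
  rewrite /e natr_sum; apply: ler_sum => v _; rewrite natr_sum.
  have D1 : (1 <= #|{: J * J}|)%N by rewrite card_prod muln_gt0 card_J.
  rewrite -{1}(avg_cst (I := (J * J)%type) 1 D1) /walk -avgB /avg mulrCA.
  apply: le_trans (_ : \sum_i phi v * (1 - phi (pi i v)) <= _).
    rewrite mulr_sumr ler_piMl ?invf_le1 ?ler1n ?ltr0n //.
    apply: sumr_ge0 => i _; rewrite /phi /chi /L.
    by case: (v \in S) (v \in I) (pi i v \in S) (pi i v \in I) => [] [] [] [].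
  apply: ler_sum => i _; rewrite /phi Lpi /chi /L.
  by case: (v \in S) (v \in I) (pi i v \in S) => [] [] [].
rewrite -(ler_nat rat) natrM natrD.
have : 0 <= t%:R :> rat by [].
have : 0 <= e%:R :> rat by [].
move: he hE hfw c23 hI ht B4'; lra.
Qed.

End Tower.
End ZigZag.

Local Open Scope nat_scope.

(** * Relational axioms for towers and their models on words *)

Section TowerAxioms.
Variables (J B : finType) (h : J -> B -> B) (beta : B -> (J * J) * (J * J)).

Notation colour := ((J * J) + B)%type.

(* [Rl (inl i) v w] says that the [i]-th edge of [v] leads to [w], and
   [Rl (inr b) v w] that [w] is the [b]-th child of [v]. *)
Definition tower (T : Type) (dom : T -> Prop) (Rl : colour -> T -> T -> Prop) :=
  (forall c v w w', dom v -> dom w -> dom w' -> Rl c v w -> Rl c v w' -> w = w') /\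
  (forall c v v' w, dom v -> dom v' -> dom w -> Rl c v w -> Rl c v' w -> v = v') /\
  (forall i v, dom v -> exists w, dom w /\ Rl (inl i) v w) /\
  (forall b b' v v' w, dom v -> dom v' -> dom w ->
    Rl (inr b) v w -> Rl (inr b') v' w -> v = v' /\ b = b') /\
  (forall b b' v w, dom v -> dom w -> Rl (inr b) v w ->
    exists w', dom w' /\ Rl (inr b') v w') /\
  (forall i b v w u, dom v -> dom w -> dom u -> Rl (inl i) v w -> Rl (inr b) v u ->
    exists u', dom u' /\ Rl (inr b) w u') /\
  (exists r, dom r /\ (forall b v, dom v -> ~ Rl (inr b) v r) /\
    forall r', dom r' -> (forall b v, dom v -> ~ Rl (inr b) v r') -> r' = r) /\
  (forall i j a v v' u w w', dom v -> dom v' -> dom u -> dom w -> dom w' ->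
    Rl (inr a) v v' -> Rl (inl (beta (h i a)).1) v u ->
    Rl (inl (beta (h i a)).2) u w -> Rl (inr (h j (h i a))) w w' ->
    Rl (inl (i, j)) v' w').

(** In a graph the vertices of a tower appear as the functions [cell -> G] that are rows. The domain
    predicate makes the axioms speak of such functions, and [f] matches them with an abstract vertex
    type. *)
Lemma tower_transfer (T T' : Type) (dom' : T' -> Prop)
    (Rl : colour -> T -> T -> Prop) (Rl' : colour -> T' -> T' -> Prop) (f : T -> T') :
  injective f -> (forall p, dom' p <-> exists v, p = f v) ->
  (forall c v w, Rl' c (f v) (f w) <-> Rl c v w) ->
  tower (fun=> True) Rl <-> tower dom' Rl'.
Proof.
move=> fI fd fR.
have df v : dom' (f v) by apply/fd; exists v.
have ex (P : T' -> Prop) : (exists w, True /\ P (f w)) <-> (exists p, dom' p /\ P p).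
  split=> [[w [_ h1]]|[p [/fd[w ->] h1]]]; first by exists (f w).
  by exists w.
split=> -[a1 [a2 [a3 [a4 [a5 [a6 [[r [r0 [r1 r2]]] a8]]]]]]].
- refine (conj _ (conj _ (conj _ (conj _ (conj _ (conj _ (conj _ _))))))).
  + move=> c _ _ _ /fd[v ->] /fd[w ->] /fd[w' ->] /fR h1 /fR h2.
    by congr f; apply: a1 h1 h2.
  + move=> c _ _ _ /fd[v ->] /fd[w ->] /fd[w' ->] /fR h1 /fR h2.
    by congr f; apply: a2 h1 h2.
  + move=> i _ /fd[v ->]; have [//|w [_ hw]] := a3 i v.
    by exists (f w); split => //; apply/fR.
  + move=> b b' _ _ _ /fd[v ->] /fd[w ->] /fd[w' ->] /fR h1 /fR h2.
    by case: (a4 _ _ _ _ _ I I I h1 h2) => -> ->.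
  + move=> b b' _ _ /fd[v ->] /fd[w ->] /fR h1.
    by have [w' [_ hw]] := a5 _ b' _ _ I I h1; exists (f w'); split => //; apply/fR.
  + move=> i b _ _ _ /fd[v ->] /fd[w ->] /fd[u ->] /fR h1 /fR h2.
    by have [w' [_ hw]] := a6 _ _ _ _ _ I I I h1 h2; exists (f w'); split => //; apply/fR.
  + exists (f r); repeat split => //; first by move=> b _ /fd[v ->] /fR /r1; apply.
    move=> _ /fd[v ->] h1; congr f; apply: r2 => // b w _ h2.
    by apply: (h1 b (f w)) => //; apply/fR.
  + move=> i j a _ _ _ _ _ /fd[v ->] /fd[v' ->] /fd[u ->] /fd[w ->] /fd[w' ->].
    by move=> /fR h1 /fR h2 /fR h3 /fR h4; apply/fR; apply: a8 h1 h2 h3 h4.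
- refine (conj _ (conj _ (conj _ (conj _ (conj _ (conj _ (conj _ _))))))).
  + move=> c v w w' _ _ _ /fR h1 /fR h2; apply: fI.
    by apply: a1 h1 h2.
  + move=> c v w w' _ _ _ /fR h1 /fR h2; apply: fI.
    by apply: a2 h1 h2.
  + move=> i v _; have [//|_ [/fd[w ->] /fR hw]] := a3 i (f v).
    by exists w.
  + move=> b b' v v' w _ _ _ /fR h1 /fR h2.
    by case: (a4 _ _ _ _ _ (df _) (df _) (df _) h1 h2) => /fI.
  + move=> b b' v w _ _ /fR h1.
    by have [_ [/fd[w' ->] /fR hw]] := a5 _ b' _ _ (df _) (df _) h1; exists w'.
  + move=> i b v w u _ _ _ /fR h1 /fR h2.
    have [_ [/fd[w' ->] /fR hw]] := a6 _ _ _ _ _ (df _) (df _) (df _) h1 h2.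
    by exists w'.
  + have [r' er] := (fd r).1 r0; rewrite er in r1 r2.
    exists r'; split=> //; split=> [b v _ /fR|v _ h1]; first exact: r1.
    apply: fI; apply: r2 => // b _ /fd[w ->] /fR; exact: h1.
  + move=> i j a v v' u w w' _ _ _ _ _ /fR h1 /fR h2 /fR h3 /fR h4.
    by apply/fR; apply: a8 h1 h2 h3 h4.
Qed.

Hypothesis h_inj : forall j, injective (h j).
Hypothesis beta_bij : bijective beta.
Hypothesis card_B : 4 <= #|B|.
Hypothesis card_J : 0 < #|J|.
Hypothesis h_contract : forall (R : realFieldType) (f : B -> R), (\sum_a f a = 0 ->
  \sum_a avg (fun j => f (h j a)) ^+ 2 <= 9%:R^-1 * \sum_a f a ^+ 2)%R.

Lemma relational_tower_expansion (V : finType) (Rl : colour -> rel V) (S : {set V}) :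
  tower (fun=> True) Rl -> 2 * #|S| <= #|V| ->
  #|S| <= 8 * \sum_c \sum_v \sum_w (Rl c v w && ((v \in S) != (w \in S))).
Proof.
move=> [a1 [a2 [a3 [a4 [a5 [a6 [[r [_ [r1 r2]]] a8]]]]]]] S2.
(* The functional tower is read off the relations; the default value in [ch] is taken exactly at
   vertices outside [I]. *)
pose I : {set V} := [set v | [exists b, [exists w, Rl (inr b) v w]]].
pose pi i v := odflt v [pick w | Rl (inl i) v w].
pose ch v b := odflt v [pick w | Rl (inr b) v w].
have piP i v : Rl (inl i) v (pi i v).
  rewrite /pi; case: pickP => // h0; have [//|w [_ hw]] := a3 i v.
  by rewrite h0 in hw.
have IP v b w : Rl (inr b) v w -> v \in I.
  by move=> hw; rewrite inE; apply/existsP; exists b; apply/existsP; exists w.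
have chP v b : v \in I -> Rl (inr b) v (ch v b).
  rewrite inE => /existsP [c /existsP [w hw]]; rewrite /ch; case: pickP => // h0.
  by have [w' [_ hw']] := a5 _ b _ _ Logic.I Logic.I hw; rewrite h0 in hw'.
have piE i v w : Rl (inl i) v w -> pi i v = w by apply: a1; rewrite ?piP.
have chE b v w : Rl (inr b) v w -> ch v b = w.
  by move=> hw; apply: a1 (hw) => //; apply: chP; apply: IP hw.
have pi_inj i : injective (pi i).
  by move=> v w e; apply: (a2 (inl i) v w (pi i v)) => //; rewrite e.
have piI i v : (pi i v \in I) = (v \in I).
  apply: closed_pi => // {}v vI.
  have /card_gt0P [b _] : 0 < #|B| by apply: leq_trans card_B.
  have [u' [_ hu]] := a6 _ _ _ _ _ Logic.I Logic.I Logic.I (piP i v) (chP _ b vI).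
  exact: IP hu.
have ch_inj v v' b b' : v \in I -> v' \in I -> ch v b = ch v' b' -> v = v' /\ b = b'.
  by move=> vI vI' e; apply: (a4 b b' v v' (ch v b)) => //; [|rewrite e]; apply: chP.
have ch_r v b : v \in I -> ch v b != r.
  by move=> vI; apply/eqP => e; apply: (r1 b v) => //; rewrite -e; exact: chP.
have ch_surj w : w != r -> exists2 v, v \in I & exists b, w = ch v b.
  move=> wr; have [[b [v hv]]|none] := pselect (exists b v, Rl (inr b) v w).
    by exists v; [exact: IP hv | exists b; rewrite (chE _ _ _ hv)].
  by case/eqP: wr; apply: r2 => // b v _ hv; apply: none; exists b, v.
have pi_ch i j v a : v \in I ->
    pi (i, j) (ch v a) = ch (pi2 pi (beta (h i a)) v) (h j (h i a)).
  move=> vI; apply: piE.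
  apply: (a8 i j a v _ (pi (beta (h i a)).1 v) (pi2 pi (beta (h i a)) v)) => //.
    exact: chP.
  by apply: chP; rewrite /pi2 !piI.
have := tower_expansion h_inj beta_bij card_B card_J h_contract pi_inj piI
  ch_inj ch_r ch_surj pi_ch S2.
move=> /leq_trans; apply; rewrite leq_mul2l /= big_sumType /=; apply: leq_add.
  rewrite exchange_big /=; apply: leq_sum => i _; apply: leq_sum => v _.
  by rewrite (bigD1 (pi i v)) //= piP /= leq_addr.
rewrite exchange_big /=; apply: leq_sum => b _.
rewrite [X in X <= _]big_mkcond /=; apply: leq_sum => v _; case: ifP => // vI.
by rewrite (bigD1 (ch v b)) //= chP //= leq_addr.
Qed.

(* [k] is fuel: the outer recursive call is on the value of the inner one. *)
Fixpoint walk_word (k : nat) (i : J * J) (s : seq B) : seq B :=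
  match k, s with
  | k'.+1, a :: w =>
      h i.2 (h i.1 a) ::
        walk_word k' (beta (h i.1 a)).2 (walk_word k' (beta (h i.1 a)).1 w)
  | _, _ => s
  end.

(** A step keeps the length of a word and each recursive call drops a letter, so the length is
    enough fuel. *)
Definition step_word (i : J * J) (s : seq B) := walk_word (size s) i s.

Lemma size_walk_word k i s : size (walk_word k i s) = size s.
Proof. by elim: k i s => [|k ih] i [|a s] //=; rewrite !ih. Qed.

Lemma step_word_cons i a w : step_word i (a :: w) =
  h i.2 (h i.1 a) ::
    step_word (beta (h i.1 a)).2 (step_word (beta (h i.1 a)).1 w).
Proof. by rewrite /step_word /= size_walk_word. Qed.

Lemma size_step_word i s : size (step_word i s) = size s.
Proof. exact: size_walk_word. Qed.

Lemma step_word_inj i : injective (step_word i).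
Proof.
move=> s; have [m] := ubnP (size s); elim: m s i => // m ih [|a s] i sm [|b t] e.
- by [].
- by have := congr1 size e; rewrite !size_step_word.
- by have := congr1 size e; rewrite !size_step_word.
move: e; rewrite !step_word_cons => -[/h_inj /h_inj -> e]; congr (_ :: _).
by apply: ih (ih _ _ _ _ e) => //; rewrite size_step_word.
Qed.

(** A vertex is the word of child labels on its way up to the root, which is the empty word. The
    words of length [n] are the leaves. *)
Definition word_rel n (c : colour) (v w : n.-bseq B) : bool :=
  match c with
  | inl i => step_word i v == w
  | inr b => b :: v == w :> seq B
  end.

(** The zig-zag axiom is the recursion equation [step_word_cons]. As steps keep lengths, they
    respect the truncation at length [n]. *)
Lemma word_tower n : tower (fun=> True) (@word_rel n).
Proof.
have mk (s : seq B) : size s <= n -> exists v : n.-bseq B, bseqval v = s.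
  by move=> sn; exists (Bseq sn).
refine (conj _ (conj _ (conj _ (conj _ (conj _ (conj _ (conj _ _))))))).
- by move=> [i|b] v w w' _ _ _ /eqP e /eqP e'; apply: val_inj; rewrite /= -e -e'.
- move=> [i|b] v w w' _ _ _ /eqP e /eqP; rewrite -e => e'; apply: val_inj => /=.
    exact: step_word_inj (esym e').
  by case: e'.
- move=> i v _; have [|w e] := mk (step_word i v).
    by rewrite size_step_word size_bseq.
  by exists w; split => //; apply/eqP.
- move=> b b' v v' w _ _ _ /eqP e /eqP; rewrite -e => -[-> e'].
  by split => //; apply: val_inj.
- move=> b b' v w _ _ /eqP e; have [|w' e'] := mk (b' :: v).
    by have := size_bseq w; rewrite -e.
  by exists w'; split => //; apply/eqP.
- move=> i b v w u _ _ _ /eqP e /eqP e'; have [|u' e''] := mk (b :: w).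
    by have := size_bseq u; rewrite -e -e' /= size_step_word.
  by exists u'; split => //; apply/eqP.
- exists [bseq]; split => //; split => // w _ h1; apply: val_inj => /=.
  case e : (bseqval w) => [|b s] //.
  have [|v ev] := mk s; first by have := size_bseq w; rewrite e => /ltnW.
  by case: (h1 b v) => //; apply/eqP; rewrite e ev.
move=> i j a v v' u w w' _ _ _ _ _ /eqP e0 /eqP e1 /eqP e2 /eqP e3.
by apply/eqP; rewrite -e0 -e3 step_word_cons e1 e2.
Qed.

End TowerAxioms.

(** * Coding by graphs of maximum degree 3 *)

Section Rows.
Variable C : finType.

Definition last_port := #|{: C * bool}|.+2.

(* Ports [0] and [1] orient the row, and the last port is never used. *)
Definition port (x : C * bool) : 'I_last_port.+1 := inord (enum_rank x).+2.

Lemma port_val x : port x = (enum_rank x).+2 :> nat.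
Proof. by rewrite /port inordK // /last_port !ltnS ltnW. Qed.

Lemma port_lt x : port x < last_port.
Proof. by rewrite port_val /last_port !ltnS. Qed.

Lemma port_inj : injective port.
Proof.
by move=> x y e; apply: enum_rank_inj; apply: val_inj; have := congr1 val e;
   rewrite /= !port_val => -[].
Qed.

(* The cells [(i, None)] form a path, [(i, Some true)] is the [i]-th port,
   attached to the path, and [(i, Some false)] is a leaf attached to the port. *)
Definition cell : finType := ('I_last_port.+1 * option bool)%type.

(** The neighbourhoods of leaves and of path cells are prescribed completely, while ports stay free
    for coloured edges. The last two clauses fix the direction of the comb. *)
Definition is_row (G : sgraph) (p : cell -> G) : Prop :=
  (forall k l, p k = p l -> k = l) /\
  (forall i j : 'I_last_port.+1, j = i.+1 :> nat -> edge (p (i, None)) (p (j, None))) /\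
  (forall i, edge (p (i, None)) (p (i, Some true))) /\
  (forall i, edge (p (i, Some true)) (p (i, Some false))) /\
  (forall i g, edge (p (i, Some false)) g -> g = p (i, Some true)) /\
  (forall i g, edge (p (i, None)) g -> g = p (i, Some true) \/
     exists j : 'I_last_port.+1, (j = i.+1 :> nat \/ i = j.+1 :> nat) /\ g = p (j, None)) /\
  edge (p (ord0, Some true)) (p (inord 1, Some true)) /\
  ~ edge (p (ord_max, Some true)) (p (inord last_port.-1, Some true)).

Definition link (c : C) (G : sgraph) (p q : cell -> G) : Prop :=
  edge (p (port (c, true), Some true)) (q (port (c, false), Some true)).

Definition row_partition (G : sgraph) : Prop :=
  (forall g : G, exists p, is_row p /\ exists k, g = p k) /\
  (forall (p q : cell -> G) k l, is_row p -> is_row q -> p k = q l -> k = l /\ p = q).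

Lemma fo_row n (a : cell -> 'I_n) : fo (fun G v => is_row (fun k => v (a k))).
Proof. by rewrite /is_row; do ! fo_step. Qed.

Lemma fo_row_partition : fo (fun G (_ : 'I_0 -> G) => row_partition G).
Proof. by rewrite /row_partition; do ! first [apply: fo_row | fo_step]. Qed.

(** * From a coloured structure to a graph of combs *)

Section Encoding.
Variables (V : finType) (Rl : C -> rel V).
Hypothesis Rl_fun : forall c v w w', Rl c v w -> Rl c v w' -> w = w'.
Hypothesis Rl_inj : forall c v v' w, Rl c v w -> Rl c v' w -> v = v'.

Definition arc v (i : 'I_last_port.+1) w (j : 'I_last_port.+1) : bool :=
  [exists c, [&& Rl c v w, i == port (c, true) & j == port (c, false)]].

Definition mu v (i : 'I_last_port.+1) w (j : 'I_last_port.+1) : bool :=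
  [|| arc v i w j, arc w j v i
    | (v == w) && ((i == 0 :> nat) && (j == 1 :> nat) || (i == 1 :> nat) && (j == 0 :> nat))].

Lemma muP v i w j : reflect
  [\/ exists c, [/\ Rl c v w, i = port (c, true) & j = port (c, false)],
      exists c, [/\ Rl c w v, j = port (c, true) & i = port (c, false)]
    | v = w /\ (i = 0 :> nat /\ j = 1 :> nat \/ i = 1 :> nat /\ j = 0 :> nat)]
  (mu v i w j).
Proof.
apply: (iffP or3P) => -[].
- by move=> /existsP [c /and3P [h1 /eqP h2 /eqP h3]]; constructor 1; exists c.
- by move=> /existsP [c /and3P [h1 /eqP h2 /eqP h3]]; constructor 2; exists c.
- move=> /andP[/eqP-> h1]; constructor 3; split=> //.
  by case/orP: h1 => /andP[/eqP-> /eqP->]; [left|right].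
- by move=> [c [h1 -> ->]]; constructor 1; apply/existsP; exists c; rewrite h1 !eqxx.
- by move=> [c [h1 -> ->]]; constructor 2; apply/existsP; exists c; rewrite h1 !eqxx.
by move=> [-> h1]; constructor 3; rewrite eqxx; case: h1 => -[-> ->].
Qed.

Lemma mu_sym v i w j : mu v i w j = mu w j v i.
Proof.
rewrite /mu orbCA; congr [|| _, _ | _]; rewrite eq_sym orbC.
by congr (_ && (_ || _)); rewrite andbC.
Qed.

Lemma mu_irr v i : mu v i v i = false.
Proof.
apply/negP => /muP [[c [_ e e']]|[c [_ e e']]|[_ [[e e']|[e e']]]].
- by have := etrans (esym e) e' => /port_inj[].
- by have := etrans (esym e) e' => /port_inj[].
- by rewrite e in e'.
by rewrite e in e'.
Qed.

Lemma mu_last v w j : mu v ord_max w j = false.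
Proof.
apply/negP => /muP [[c [_ e _]]|[c [_ _ e]]|[_ [[e _]|[e _]]]] //.
  by have := port_lt (c, true); rewrite -e ltnn.
by have := port_lt (c, false); rewrite -e ltnn.
Qed.

(** A port determines a colour and a direction, and every colour is functional both ways. So the
    port edges form a matching, which keeps the degree of ports at most 3. *)
Lemma mu_fun v i w j w' j' : mu v i w j -> mu v i w' j' -> (w, j) = (w', j').
Proof.
move=> /muP [[c [h1 -> ->]]|[c [h1 -> ->]]|[-> h1]]
       /muP [[c' [h2 e ->]]|[c' [h2 -> e]]|[<- h2]].
- by case/port_inj: e h2 => <- /(Rl_fun h1) ->.
- by case/port_inj: e.
- by rewrite port_val in h2; case: h2 => -[].
- by case/port_inj: e.
- by case/port_inj: e h2 => <- /(Rl_inj h1) ->.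
- by rewrite port_val in h2; case: h2 => -[].
- by move: h1; rewrite e port_val => -[] [].
- by move: h1; rewrite e port_val => -[] [].
congr (_, _); apply: val_inj => /=.
by case: h1 h2 => -[-> ->] [] [].
Qed.

Lemma mu_port c v w : mu v (port (c, true)) w (port (c, false)) = Rl c v w.
Proof.
apply/muP/idP => [|h1]; last by constructor 1; exists c.
move=> [[c' [h1 e _]]|[c' [_ e _]]|].
- by case/port_inj: e => ->.
- by case/port_inj: e.
by rewrite !port_val => -[_ [[]|[]]].
Qed.

Definition enc_edge (x y : V * cell) : bool :=
  let: (v, (i, k)) := x in let: (w, (j, l)) := y in
  match k, l with
  | None, None => (v == w) && ((j == i.+1 :> nat) || (i == j.+1 :> nat))
  | None, Some true | Some true, None
  | Some true, Some false | Some false, Some true => (v == w) && (i == j)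
  | Some true, Some true => mu v i w j
  | _, _ => false
  end.

Lemma enc_edge_sym : symmetric enc_edge.
Proof.
move=> [v [i [[]|]]] [w [j [[]|]]] //=; rewrite 1?mu_sym // eq_sym;
  by rewrite 1?[i == j]eq_sym 1?[in RHS]orbC.
Qed.

Lemma enc_edge_irr : irreflexive enc_edge.
Proof.
move=> [v [i [[]|]]] //=; first exact: mu_irr.
by rewrite eqxx /= orbb; apply/negP => /eqP; lia.
Qed.

Definition enc : sgraph := SGraph enc_edge_sym enc_edge_irr.

Lemma enc_max_degree : max_degree enc <= 3.
Proof.
apply/bigmax_leqP => x _; rewrite /degree.
suff [s s3 hs] : exists2 s : seq enc, size s <= 3 & forall y, edge x y -> y \in s.
  apply: leq_trans s3; apply: leq_trans (card_size s); apply: subset_leq_card.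
  by apply/subsetP => y; rewrite inE; exact: hs.
case: x => v [i [[]|]].
- pose part := [pick y : V * 'I_last_port.+1 | mu v i y.1 y.2].
  exists [:: (v, (i, None)); (v, (i, Some false));
     if part is Some y then (y.1, (y.2, Some true)) else (v, (i, None))] => //.
  move=> [w [j [[]|]]] /=; last 2 first.
  + by move=> /andP[/eqP<- /eqP<-]; rewrite !inE eqxx orbT.
  + by move=> /andP[/eqP<- /eqP<-]; rewrite !inE eqxx.
  rewrite /part => h1; case: pickP => [[w' j'] /= h2|/(_ (w, j))/=]; last by rewrite h1.
  by case: (mu_fun h1 h2) => -> ->; rewrite !inE eqxx !orbT.
- exists [:: (v, (i, Some true))] => // -[w [j [[]|]]] //=.
  by move=> /andP[/eqP<- /eqP<-]; rewrite inE.
exists [:: (v, (inord i.+1, None)); (v, (inord i.-1, None)); (v, (i, Some true))] => //.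
move=> [w [j [[]|]]] //=; last move=> /andP[/eqP<- /orP[] /eqP e].
- by move=> /andP[/eqP<- /eqP<-]; rewrite !inE eqxx !orbT.
- by rewrite -e inord_val inE eqxx.
by rewrite e /= inord_val !inE eqxx orbT.
Qed.

(** Combs are rigid: degree-one vertices locate the leaves, then the ports, then the path cells, and
    the marked ports orient the path. *)
Lemma enc_rowP (p : cell -> enc) : is_row p <-> exists v, p = (fun k => (v, k)).
Proof.
split; last first.
  move=> [v ->]; refine (conj _ (conj _ (conj _ (conj _ (conj _ (conj _ (conj _ _))))))).
  - by move=> k l [].
  - by move=> i j e /=; rewrite e !eqxx.
  - by move=> i /=; rewrite !eqxx.
  - by move=> i /=; rewrite !eqxx.
  - by move=> i [w [j [[]|]]] //= /andP[/eqP<- /eqP<-].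
  - move=> i [w [j [[]|]]] //= /andP[/eqP<-]; first by move/eqP <-; left.
    by move=> /orP[]/eqP e; right; exists j; split => //; [left|right].
  - by apply/muP; constructor 3; split => //; left; rewrite inordK.
  by rewrite /= mu_last.
move=> [inj [xx [xy [yz [zn [xn [mark0 mark1]]]]]]].
have adj (j : 'I_last_port.+1) : exists j' : 'I_last_port.+1,
    (j' == j.+1 :> nat) || (j == j'.+1 :> nat).
  have [lt|ge] := ltnP j last_port.
    by exists (inord j.+1); rewrite inordK ?eqxx.
  exists (inord j.-1); rewrite inordK; last by have := ltn_ord j; lia.
  by apply/orP; right; apply/eqP; rewrite prednK //; apply: leq_trans ge.
(* A cell that is not a leaf of the code has two distinct neighbours, contrary to the leaf clause of
   [is_row]. *)
have leaf i : exists v j, p (i, Some false) = (v, (j, Some false)) /\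
    p (i, Some true) = (v, (j, Some true)).
  have := zn i; case: (p (i, Some false)) => v [j [[]|]] h1.
  - have e1 := h1 (v, (j, None)); have e2 := h1 (v, (j, Some false)).
    by rewrite /= !eqxx in e1 e2; have := e1 isT; rewrite -(e2 isT).
  - exists v, j; split=> //.
    by symmetry; apply: h1; rewrite /= !eqxx.
  have [j' hj] := adj j.
  have e1 := h1 (v, (j, Some true)); have e2 := h1 (v, (j', None)).
  by rewrite /= ?eqxx ?hj in e1 e2; have := e1 isT; rewrite -(e2 isT).
have cellE i : exists v j, forall k, p (i, k) = (v, (j, k)).
  have [v [j [ez ey]]] := leaf i; exists v, j.
  suff ex : p (i, None) = (v, (j, None)) by move=> [[]|].
  have := xy i; rewrite edge_sym ey.
  case ex : (p (i, None)) => [w [j' [[]|]]] //=; last by move=> /andP[/eqP<- /eqP<-].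
    (* If the path cell landed on a port, the leaf at that port would have to be another path cell
       of the row, and the port of that cell would coincide with [p (i, None)]. *)
    move=> _; have [|e|[i' [_ e]]] := xn i (w, (j', Some false)).
    - by rewrite ex /= !eqxx.
    - by rewrite ey in e.
    have := xy i'; rewrite -e; have [w' [j'' [_ e']]] := leaf i'; rewrite e' /=.
    move=> /andP[/eqP ew /eqP ej]; have := inj (i', Some true) (i, None).
    by rewrite e' ex ew ej => /(_ erefl).
  move=> /andP[/eqP ew /eqP ej]; have := inj (i, None) (i, Some false).
  by rewrite ex ez ew ej => /(_ erefl).
have [v [j0 e0]] := cellE ord0.
have [w [j1 e1]] := cellE (inord 1).
have one : (inord 1 : 'I_last_port.+1) = 1 :> nat by rewrite inordK.
have := xx ord0 (inord 1) one; rewrite e0 e1 /= => /andP[/eqP vw j01]; subst w.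
have only (j : 'I_last_port.+1) : (j == j0.+1 :> nat) || (j0 == j.+1 :> nat) -> j = j1.
  move=> hj; have := xn ord0 (v, (j, None)); rewrite e0 /= eqxx hj => /(_ isT).
  case=> [|[j' [[ej'|//]]]]; first by rewrite e0.
  by have -> : j' = inord 1 by [apply: val_inj; rewrite /= one]; rewrite e1 => -[].
(* The first path cell has only one path neighbour, so it lands on an end. The last end is excluded
   because its port carries no port edge. *)
have j00 : j0 = 0 :> nat.
  have [lt|ge] := ltnP j0 last_port.
    have e2 : j1 = j0.+1 :> nat.
      by rewrite -(only (inord j0.+1)) inordK ?eqxx.
    case z : (nat_of_ord j0) => [//|m].
    have e3 : j1 = m :> nat.
      by rewrite -(only (inord m)) inordK ?z ?eqxx ?orbT //; have := ltn_ord j0; lia.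
    by lia.
  have jl : j0 = ord_max by apply: val_inj; apply/eqP; rewrite eqn_leq ge -ltnS ltn_ord.
  by move: mark0; rewrite e0 e1 jl /= mu_last.
exists v; apply: funext => -[i k].
(* The next cell of the code is the image of the next or of the previous cell of the row, and the
   previous one is already placed. *)
have main m : forall i : 'I_last_port.+1, i <= m -> p (i, None) = (v, (i, None)).
  elim: m => [|m ih] {}i im.
    have -> : i = ord0 by apply: val_inj; apply/eqP; rewrite /= -leqn0.
    by rewrite e0 (_ : j0 = ord0) //; apply: val_inj.
  move: im; rewrite leq_eqVlt ltnS => /orP[/eqP im|]; last exact: ih.
  have mlt : m < last_port.+1 by have := ltn_ord i; lia.
  pose i' : 'I_last_port.+1 := Ordinal mlt.
  have ei' : p (i', None) = (v, (i', None)) by apply: ih.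
  have := xn i' (v, (i, None)); rewrite ei' /= eqxx im eqxx => /(_ isT) [].
    by have [w [j [_ ->]]] := leaf i'.
  move=> [j [[ej|ej] e]].
    by rewrite e; congr (p (_, _)); apply: val_inj; rewrite /= ej.
  have : p (j, None) = (v, (j, None)) by apply: ih; rewrite /= in ej; lia.
  by rewrite -e => -[] eij; move: im; rewrite eij; rewrite /= in ej; lia.
have [w [j ej]] := cellE i; rewrite ej.
by have := ej None; rewrite (main i i (leqnn _)) => -[-> ->].
Qed.

Lemma enc_row_partition : row_partition enc.
Proof.
split=> [[v k]|p q k l /enc_rowP[v ->] /enc_rowP[w ->] [-> ->]//].
by exists (fun k => (v, k)); split; [apply/enc_rowP; exists v | exists k].
Qed.

End Encoding.

(** * From rows back to a tower, and transfer of expansion *)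

Section Decoding.
Variable G : sgraph.
Hypothesis rows : row_partition G.

Definition rowT : finType := {p : {ffun cell -> G} | `[< is_row p >]}.

Definition row_link (c : C) (v w : rowT) : bool := `[< link c (val v) (val w) >].

Lemma rowTP (v : rowT) : is_row (val v).
Proof. by case: v => p /= /asboolP. Qed.

Lemma rowTE (p : cell -> G) : is_row p <-> exists v : rowT, p = val v.
Proof.
split=> [hp|[v ->]]; last exact: rowTP.
have hp' : `[< is_row (finfun p) >].
  by apply/asboolP; rewrite (_ : fun_of_fin _ = p) //; apply: funext => k; rewrite ffunE.
by exists (exist _ (finfun p) hp'); apply: funext => k /=; rewrite ffunE.
Qed.

Lemma cell_bij : bijective (fun x : rowT * cell => val x.1 x.2).
Proof.
apply: inj_card_bij => [[v k] [w l] /= e|].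
  have [-> evw] := rows.2 _ _ _ _ (rowTP v) (rowTP w) e; congr (_, _).
  by apply: val_inj; apply/ffunP => x; rewrite evw.
apply: leq_trans (_ : #|codom (fun x : rowT * cell => val x.1 x.2)| <= _).
  apply: subset_leq_card; apply/subsetP => g _.
  have [p [/rowTE [v ->] [k ->]]] := rows.1 g.
  exact: (codom_f (fun x : rowT * cell => val x.1 x.2) (v, k)).
exact: leq_image_card.
Qed.

Lemma sum_cells (f : G -> nat) : \sum_g f g = \sum_(v : rowT) \sum_k f (val v k).
Proof.
rewrite pair_bigA [LHS](reindex _ (onW_bij _ cell_bij)) /=.
by apply: eq_bigr => -[].
Qed.

Section Expansion.
Hypothesis link_fun : forall c v w w', row_link c v w -> row_link c v w' -> w = w'.
Hypothesis link_inj : forall c v v' w, row_link c v w -> row_link c v' w -> v = v'.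
Hypothesis base_expansion : forall T : {set rowT}, 2 * #|T| <= #|rowT| ->
  #|T| <= 8 * \sum_c \sum_v \sum_w (row_link c v w && ((v \in T) != (w \in T))).
Variable S : {set G}.

Let crossing (x y : G) : bool := edge x y && ((x \in S) != (y \in S)).

(** Each boundary edge is counted once in either orientation. *)
Lemma crossing_boundary :
  \sum_x \sum_y crossing x y <= 2 * #|edge_boundary S|.
Proof.
pose X := [set z : G * G | [&& z.1 \in S, z.2 \notin S & edge z.1 z.2]].
have XS : #|X| <= #|edge_boundary S|.
  have X_inj : {in X &, injective (fun z : G * G => [set z.1; z.2])}.
    move=> [x y] [x' y']; rewrite !inE /= => /and3P[xS yS _] /and3P[xS' yS' _] e.
    have : x \in [set x'; y'] by rewrite -e !inE eqxx.
    have : y \in [set x'; y'] by rewrite -e !inE eqxx orbT.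
    rewrite !inE => /orP[]/eqP ey /orP[]/eqP ex; subst => //.
    - by rewrite xS' in yS.
    - by rewrite xS' in yS.
    by rewrite xS in yS'.
  rewrite -(card_in_imset X_inj); apply: subset_leq_card.
  apply/subsetP => _ /imsetP [[x y] + ->]; rewrite inE /= => /and3P[xS yS xy].
  by apply/imset2P; exists x y; rewrite ?inE ?xS ?yS.
have sumX : \sum_x \sum_y ((x \in S) && (y \notin S) && edge x y) = #|X|.
  rewrite pair_bigA -sum1_card [RHS]big_mkcond /=; apply: eq_bigr => z _.
  by rewrite inE -andbA; case: ifP.
rewrite mul2n -addnn; apply: leq_trans (leq_add XS XS).
rewrite -{1}sumX -sumX [X in _ + X]exchange_big -big_split /=.
apply: leq_sum => x _; rewrite -big_split /=; apply: leq_sum => y _.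
rewrite /crossing [edge y x]edge_sym.
by case: (edge x y) (x \in S) (y \in S) => [] [] [].
Qed.

Let full := [set v : rowT | [forall k, val v k \in S]].
Let mixed := [set v : rowT | [exists k, val v k \in S] && [exists k, val v k \notin S]].

(** A row is connected, so membership in [S] cannot change inside it without a crossing edge. *)
Lemma row_crossing (v : rowT) : v \in mixed ->
  0 < \sum_k \sum_l crossing (val v k) (val v l).
Proof.
move=> vm; rewrite lt0n; apply/negP => /eqP s0.
have nc k l : edge (val v k) (val v l) -> (val v k \in S) = (val v l \in S).
  move=> ekl; apply/eqP/negPn/negP => ne; move/eqP: s0; rewrite sum_nat_eq0.
  move=> /forallP /(_ k) /=; rewrite sum_nat_eq0 => /forallP /(_ l) /=.
  by rewrite /crossing ekl ne.
have [_ [xx [xy [yz _]]]] := rowTP v.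
have c0 m : forall i : 'I_last_port.+1, i <= m ->
    (val v (i, None) \in S) = (val v (ord0, None) \in S).
  elim: m => [|m ih] i im.
    by congr (val v (_, _) \in S); apply: val_inj; apply/eqP; rewrite /= -leqn0.
  move: im; rewrite leq_eqVlt ltnS => /orP[/eqP im|]; last exact: ih.
  have mlt : m < last_port.+1 by have := ltn_ord i; lia.
  by rewrite -(ih (Ordinal mlt) (leqnn _)) -(nc (Ordinal mlt, None)) //; apply: xx.
have ck k : (val v k \in S) = (val v (ord0, None) \in S).
  case: k => i k; rewrite -(c0 i i (leqnn _)).
  case: k => [[]|] //; first by rewrite (nc _ _ (xy i)).
  by rewrite (nc _ _ (xy i)) (nc _ _ (yz i)).
move: vm; rewrite inE => /andP[/existsP [k] + /existsP [l]].
by rewrite !ck => ->.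
Qed.

Let E := \sum_x \sum_y crossing x y.

Lemma crossing_cells : E =
  \sum_(v : rowT) \sum_(w : rowT) \sum_k \sum_l crossing (val v k) (val w l).
Proof.
rewrite /E sum_cells; apply: eq_bigr => v _; rewrite [RHS]exchange_big /=.
by apply: eq_bigr => k _; rewrite sum_cells.
Qed.

Lemma mixed_crossing : #|mixed| <= E.
Proof.
rewrite crossing_cells -sum1_card big_mkcond /=; apply: leq_sum => v _.
case: ifP => // vm; apply: leq_trans (row_crossing vm) _.
by rewrite [leqRHS](bigD1 v) //= leq_addr.
Qed.

(** If a link separates a full row from another, either its port edge crosses [S] or the other row
    meets [S] and is mixed. A row has at most one outgoing and one incoming link of colour [c],
    which bounds the sum by [E] plus twice the number of mixed rows. *)
Lemma full_crossing c :
  \sum_v \sum_w (row_link c v w && ((v \in full) != (w \in full))) <= 3 * E.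
Proof.
pose o := (port (c, true), Some true) : cell.
pose i := (port (c, false), Some true) : cell.
have atmost1 (P : pred rowT) (b : bool) : (forall w w', P w -> P w' -> w = w') ->
    \sum_w (P w && b) <= b.
  move=> hP; case: b; last by rewrite big1 // => w _; rewrite andbF.
  have [w0 Pw0|P0] := pickP P; last by rewrite big1 // => w _; rewrite P0.
  rewrite (bigD1 w0) //= big1 ?addn0; first by case: (P w0).
  by move=> w /eqP ww0; case Pw: (P w) => //; case: ww0; apply: hP.
apply: leq_trans (_ : \sum_(v : rowT) \sum_(w : rowT) crossing (val v o) (val w i) +
  (\sum_v \sum_w (row_link c v w && (v \in mixed)) +
   \sum_v \sum_w (row_link c v w && (w \in mixed))) <= _).
  rewrite -!big_split; apply: leq_sum => v _; rewrite -!big_split.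
  apply: leq_sum => w _ /=.
  case lk: (row_link c v w) => //=; have [//|ne] := eqVneq (v \in full) (w \in full).
  have eoi : edge (val v o) (val w i) by move: lk => /asboolP.
  rewrite /crossing eoi /=.
  have [eS|//] := eqVneq (val v o \in S) (val w i \in S).
  have notfull u k : u \in full -> val u k \in S by rewrite inE => /forallP.
  have mix u k : u \notin full -> val u k \in S -> u \in mixed.
    rewrite !inE negb_forall => h1 h2; rewrite h1 andbT.
    by apply/existsP; exists k.
  move: ne; case vf: (v \in full); case wf: (w \in full) => // _.
    by rewrite (mix w i) ?wf ?addn1 // -eS notfull.
  by rewrite (mix v o) ?vf // eS notfull.
have h1 : \sum_(v : rowT) \sum_(w : rowT) crossing (val v o) (val w i) <= E.
  rewrite crossing_cells; apply: leq_sum => v _; apply: leq_sum => w _.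
  by rewrite (bigD1 o) //= (bigD1 i) //= -addnA leq_addr.
have h2 : \sum_v \sum_w (row_link c v w && (v \in mixed)) <= #|mixed|.
  rewrite -sum1_card [leqRHS]big_mkcond; apply: leq_sum => v _ /=.
  apply: leq_trans (atmost1 (row_link c v) _ _) _; first exact: link_fun.
  by case: ifP.
have h3 : \sum_v \sum_w (row_link c v w && (w \in mixed)) <= #|mixed|.
  rewrite exchange_big -sum1_card [leqRHS]big_mkcond; apply: leq_sum => w _ /=.
  apply: leq_trans (atmost1 (row_link c ^~ w) _ _) _; last by case: ifP.
  by move=> v v'; exact: link_inj.
by have := mixed_crossing; lia.
Qed.

(** [S] is covered by full and mixed rows. Tower expansion bounds the full ones by [24 * #|C| * E],
    mixed rows number at most [E], and [E] is at most twice the boundary. *)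
Lemma rows_expansion : 2 * #|S| <= #|G| ->
  #|S| <= 2 * #|cell| * (24 * #|C| + 1) * #|edge_boundary S|.
Proof.
move=> S2.
have cS : #|S| = \sum_(v : rowT) \sum_k (val v k \in S).
  rewrite -(sum_cells (fun g => (g \in S) : nat)) -sum1_card big_mkcond /=.
  by apply: eq_bigr => g _; case: ifP.
have cG : #|G| = #|rowT| * #|cell| by rewrite -(bij_eq_card cell_bij) card_prod.
have K0 : 0 < #|cell| by apply/card_gt0P; exists (ord0, None).
have fS : #|full| * #|cell| <= #|S|.
  rewrite cS -sum1_card big_distrl /= [leqLHS]big_mkcond; apply: leq_sum => v _ /=.
  case: ifP => //; rewrite inE => /forallP vS; rewrite mul1n -sum1_card.
  by apply: leq_sum => k _; rewrite vS.
have f2 : 2 * #|full| <= #|rowT|.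
  by rewrite -(leq_pmul2r K0) -cG; apply: leq_trans S2; rewrite -mulnA leq_mul2l.
have Sfm : #|S| <= #|cell| * (#|full| + #|mixed|).
  rewrite cS mulnDr mulnC [X in _ + X]mulnC -[#|full|]sum1_card -[#|mixed|]sum1_card.
  rewrite !big_distrl /=.
  rewrite ![\sum_(_ in full) _]big_mkcond ![\sum_(_ in mixed) _]big_mkcond -big_split /=.
  apply: leq_sum => v _.
  have le1 : \sum_k (val v k \in S) <= #|cell|.
    by rewrite -sum1_card; apply: leq_sum => k _; case: (_ \in S).
  case vf: (v \in full); first by rewrite mul1n (leq_trans le1) ?leq_addr.
  case vm: (v \in mixed); first by rewrite add0n mul1n.
  rewrite big1 // => k _; apply/eqP; rewrite eqb0; apply/negP => kS.
  move: vm; rewrite inE; move: vf; rewrite inE => /negbT; rewrite negb_forall => ->.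
  by rewrite andbT => /existsP; apply; exists k.
have fE : #|full| <= 8 * (#|C| * (3 * E)).
  apply: leq_trans (base_expansion f2) _; rewrite leq_mul2l /= -sum_nat_const.
  by apply: leq_sum => c _; exact: full_crossing.
apply: leq_trans Sfm _.
have h1 : #|full| + #|mixed| <= (24 * #|C| + 1) * (2 * #|edge_boundary S|).
  apply: leq_trans (_ : (24 * #|C| + 1) * E <= _).
    by have := mixed_crossing; lia.
  by rewrite leq_mul2l crossing_boundary orbT.
have := leq_mul (leqnn #|cell|) h1; lia.
Qed.

End Expansion.
End Decoding.
End Rows.

(** * The sentence and its class of models *)

Lemma fo_tower (J B : finType) (h : J -> B -> B) (beta : B -> (J * J) * (J * J)) :
  fo (fun G (_ : 'I_0 -> G) =>
    tower h beta (@is_row ((J * J) + B)%type G) (fun c => @link _ c G)).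
Proof.
by rewrite /tower /link; do ! first [apply: fo_row | fo_step].
Qed.

Lemma expander_of_cut_bound (R : realType) (G : sgraph) (k : nat) :
  (forall S : {set G}, 2 * #|S| <= #|G| -> #|S| <= k * #|edge_boundary S|)%N ->
  (0 < k)%N -> expander (k%:R^-1 : R) G.
Proof.
move=> hS k0; rewrite /expander /expansion_ratio.
elim/big_ind: _ => [|x y hx hy|S /andP[S0 S2]].
- exact: leey.
- by rewrite le_min hx.
rewrite lee_fin /cut_ratio ler_pdivlMr ?ltr0n // ler_pdivrMl ?ltr0n //.
by rewrite -natrM ler_nat hS.
Qed.

Lemma card_bseq_gt (B : finType) n : (0 < #|B|)%N -> (n < #|{: n.-bseq B}|)%N.
Proof.
move=> /card_gt0P [b _].
have sz (i : 'I_n.+1) : (size (nseq i b) <= n)%N by rewrite size_nseq -ltnS.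
have inj : injective (fun i => Bseq (sz i)).
  by move=> i j [] /(congr1 size); rewrite !size_nseq => /val_inj.
by have := leq_card _ inj; rewrite card_ord.
Qed.

Local Open Scope ring_scope.

Theorem theorem5p7 (R : realType) :
  exists (xi : R) (psi : sentence),
    [/\ 0 < xi,
        infinite_class (bounded_degree_models 3 psi)
      & forall G : sgraph, bounded_degree_models 3 psi G -> expander xi G].
Proof.
have [J [B [h [beta [h_inj beta_bij card_B card_J h_contract]]]]] := base_expander.
pose C : finType := ((J * J) + B)%type.
have [psi psiP] := fo_and (fo_row_partition C) (fo_tower h beta).
pose k := (2 * #|cell C| * (24 * #|C| + 1))%N.
have k0 : (0 < k)%N.
  rewrite /k !muln_gt0 addn1 /= andbT.
  by apply/card_gt0P; exists (ord0, None).
exists k%:R^-1, psi; split; first by rewrite invr_gt0 ltr0n.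
- move=> [m [F hF]].
  (* The tower of words of length at most [n] has more than [n] vertices, so its code is larger than
     every listed graph. *)
  pose n := (\max_(i < m) #|F i|)%N; pose V := n.-bseq B : finType.
  have [a1 [a2 _]] := word_tower beta h_inj n.
  have Rfun c v w w' : word_rel h beta c v w -> word_rel h beta c v w' -> w = w' :> V.
    exact: a1.
  have Rinj c v v' w : word_rel h beta c v w -> word_rel h beta c v' w -> v = v' :> V.
    exact: a2.
  pose G := enc (word_rel h beta (n := n) : C -> rel V).
  have GM : bounded_degree_models 3 psi G.
    split; first exact: enc_max_degree.
    apply/psiP; split; first exact: enc_row_partition.
    have := word_tower beta h_inj n.
    apply: (@tower_transfer _ _ h beta V (cell C -> G) _ _ _ (fun v k => (v, k)) _ _ _).1.
    + by move=> v w /(congr1 (@^~ (ord0, None))) [].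
    + exact: enc_rowP.
    by move=> c v w; rewrite /link /= mu_port.
  have [i [f [bf _]]] := hF G GM.
  have : (#|G| <= n)%N by rewrite (bij_eq_card bf) (leq_bigmax i).
  rewrite leqNgt card_prod => /negP; apply.
  apply: leq_trans (card_bseq_gt n (leq_trans _ card_B)) _ => //.
  by apply: leq_pmulr; apply/card_gt0P; exists (ord0, None).
move=> G [_ /psiP [rows tow]]; apply: expander_of_cut_bound => // S S2.
(* The rows of an arbitrary model carry a tower, whose expansion passes to the graph. *)
have tow' : tower h beta (fun=> True) (fun c => @row_link C G c).
  move: tow; apply: (@tower_transfer _ _ h beta (rowT C G) (cell C -> G) _ _ _
    (fun v => val v) _ _ _).2.
  + by move=> v w e; apply: val_inj; apply/ffunP => x; rewrite e.
  + exact: rowTE.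
  by move=> c v w; split=> /asboolP.
apply: rows_expansion => //.
- by move=> c v w w' h1 h2; apply: tow'.1 h1 h2.
- by move=> c v w w' h1 h2; apply: tow'.2.1 h1 h2.
by move=> T T2; apply: (relational_tower_expansion _ _ _ _ _ tow' T2).
Qed.
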